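(* Let $n$ be even and $\mathbf X=\mathbf U+\mathbf E\in\mathbb R^{n\times p}$, where $\mathbf U_{1\cdot}=\dots=\mathbf U_{n/2\cdot}=\mathbf c_1$, $\mathbf U_{n/2+1\cdot}=\dots=\mathbf U_{n\cdot}=\mathbf c_2$, and the rows of $\mathbf E$ are independent, mean zero, with sub-Gaussian norm $\sigma_p$. Let $\boldsymbol\Phi\in\{0,1\}^{n\times n}$ be random, symmetric with zero diagonal, independent of $\mathbf E$, with entries $\Phi_{ij}$, $i<j$, independent Bernoulli random variables with $$p_w=P(\Phi_{ij}=1\mid\mathbf U_{i\cdot}=\mathbf U_{j\cdot}),\qquad p_b=P(\Phi_{ij}=1\mid\mathbf U_{i\cdot}\ne\mathbf U_{j\cdot}).$$ Let $G=(V,\mathcal E)$ be the corresponding graph with oriented edge-incidence matrix $\mathbf F$. If, as $n\to\infty$, $p_w=\omega(\log(n)/n)$, $p_b=\omega(\log(n)/n)$ and $\frac{np_b^2}{p_w+p_b}=\omega(\log n)$, then $$\frac{\|\mathbf F^\dagger\mathbf E\|_{\max}}{n}\sum_{(i,j)\in\mathcal E}\sqrt{\Phi_{ij}}\,\|\mathbf U_{i\cdot}-\mathbf U_{j\cdot}\|_2=O_p\Big(\sqrt{\log n}\Big(\frac{p_b}{p_w+p_b}+\frac{1}{\sqrt n(p_w+p_b)}\Big)\Big).$$ Consequently, if in addition $p_w=\omega\big(\sqrt{\log(n)/n}\big)$ and $p_w=\omega(p_b\sqrt{\log n})$, then the left-hand side converges to zero in probability.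
   Context: The sub-Gaussian norm of a random vector $\mathbf Y\in\mathbb R^p$ is $\sup_{\|\mathbf v\|_2=1}\inf\{K>0:\mathbb E[\exp((\mathbf v^\top\mathbf Y)^2/K^2)]\le2\}$. Here $p_w,p_b$ are sequences depending on $n$. Edges $(i,j)\in\mathcal E$ are indexed with $i<j$. An oriented edge-incidence matrix $\mathbf F\in\mathbb R^{n\times|\mathcal E|}$ has, for each edge $(j,k)$ with column index $\mathcal E(j,k)$, entries $\mathbf F_{j,\mathcal E(j,k)}=-\mathbf F_{k,\mathcal E(j,k)}=\sqrt{\Phi_{jk}}$ and zeros elsewhere. $\mathbf F^\dagger$ is the Moore–Penrose pseudoinverse and $\|\cdot\|_{\max}$ the maximum absolute entry. *)

(* Defs.v *)
From HB Require Import structures.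
From mathcomp Require Import all_boot all_order all_algebra.
From mathcomp Require Import all_classical all_reals all_analysis.
Set Implicit Arguments. Unset Strict Implicit. Unset Printing Implicit Defensive.
Import Order.TTheory GRing.Theory Num.Theory.
Import numFieldNormedType.Exports.
Local Open Scope classical_set_scope.
Local Open Scope ring_scope.

Section Defs.
Variable R : realType.

Definition l2norm {p : nat} (v : 'rV[R]_p) : R := Num.sqrt (\sum_(k < p) v 0 k ^+ 2).

Definition maxnorm {m q : nat} (M : 'M[R]_(m, q)) : R :=
  \big[Num.max/0]_(i < m) \big[Num.max/0]_(j < q) `|M i j|.

Definition is_MP_pinv {m q : nat} (A : 'M[R]_(m, q)) (X : 'M[R]_(q, m)) : Prop :=
  [/\ A *m X *m A = A, X *m A *m X = X, (A *m X)^T = A *m X & (X *m A)^T = X *m A].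

Definition edges {N : nat} (phi : 'M[R]_N) : {set 'I_N * 'I_N} :=
  [set e : 'I_N * 'I_N | (e.1 < e.2)%N && (phi e.1 e.2 == 1)].

Definition incidence {N : nat} (phi : 'M[R]_N) : 'M[R]_(N, #|edges phi|) :=
  \matrix_(v < N, c < #|edges phi|)
    let e := enum_val c in
    if v == e.1 then Num.sqrt (phi e.1 e.2)
    else if v == e.2 then - Num.sqrt (phi e.1 e.2) else 0.

Definition Umat (m p : nat) (c1 c2 : 'rV[R]_p) : 'M[R]_(m.*2, p) :=
  \matrix_(i < m.*2, k < p) if (i < m)%N then c1 0 k else c2 0 k.

Section Prob.
Context {d : measure_display} {T : measurableType d}.
Variable P : probability T R.

Definition mutually_indep {I : finType} (F : I -> set (set T)) : Prop :=
  forall A : I -> set T, (forall i, F i (A i)) ->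
    P [set w | forall i, A i w] = (\prod_(i : I) P (A i))%E.

Definition indep2 (F G : set (set T)) : Prop :=
  forall A B, F A -> G B -> P (A `&` B) = (P A * P B)%E.

(* events determined by row i of a random matrix (measurable rectangles; they form
   a pi-system generating the sigma-algebra of the row) *)
Definition row_events {n p : nat} (X : T -> 'M[R]_(n, p)) (i : 'I_n) : set (set T) :=
  fun A => exists B : 'I_p -> set R, (forall k, measurable (B k)) /\
    A = [set w | forall k, B k (X w i k)].

Definition mx_events {n p : nat} (X : T -> 'M[R]_(n, p)) : set (set T) :=
  fun A => exists B : 'I_n -> 'I_p -> set R, (forall i k, measurable (B i k)) /\
    A = [set w | forall i k, B i k (X w i k)].

(* events determined by a finitely-valued real random variable *)
Definition rv_events (Y : T -> R) : set (set T) :=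
  fun A => exists B : set R, A = Y @^-1` B.

(* events determined by a finitely-valued random matrix *)
Definition fmx_events {n : nat} (Y : T -> 'M[R]_n) : set (set T) :=
  fun A => exists B : set 'M[R]_n, A = Y @^-1` B.

Definition subg_norm {p : nat} (Y : T -> 'rV[R]_p) : \bar R :=
  ereal_sup [set ereal_inf [set (K%:E) | K in
       [set K : R | 0 < K /\
          (\int[P]_w (expR (((v *m (Y w)^T) 0 0) ^+ 2 / K ^+ 2))%:E <= 2%:E)%E]]
     | v in [set v : 'rV[R]_p | l2norm v = 1]].
End Prob.

Definition little_omega (a b : nat -> R) : Prop :=
  forall M : R, \forall m \near \oo, M * `|b m| <= `|a m|.

Section Seq.
Context {d : nat -> measure_display} {T : forall m, measurableType (d m)}.
Variable P : forall m, probability (T m) R.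

Definition bigO_p (X : forall m, T m -> R) (a : nat -> R) : Prop :=
  forall eps : R, 0 < eps -> exists M : R, 0 < M /\
    \forall m \near \oo, (P m [set w | (M * `|a m| < `|X m w|)%R] < eps%:E)%E.

Definition cvg_prob0 (X : forall m, T m -> R) : Prop :=
  forall eps : R, 0 < eps ->
    (fun m => fine (P m [set w | eps < `|X m w|])) @ \oo --> (0 : R).
End Seq.
End Defs.

(* Main.v *)
Require Import Defs.
From HB Require Import structures.
From mathcomp Require Import all_boot all_order all_algebra.
From mathcomp Require Import all_classical all_reals all_analysis.
From mathcomp Require Import measurable_realfun zify ring lra.
Import Order.TTheory GRing.Theory Num.Theory.
Import numFieldNormedType.Exports.
Set Implicit Arguments.
Unset Strict Implicit.
Unset Printing Implicit Defensive.
Local Open Scope ring_scope.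

(* A row [x] of the pseudoinverse of the incidence matrix, indexed by an edge (j, l),
   has zero sum and solves [L x = e_j - e_l] for the graph Laplacian [L].  With high
   probability (Chernoff and union bounds over vertex subsets) both blocks have edge
   expansion of order [n pw], the whole graph has edge expansion of order [n pb], and
   degrees are of the expected order, so Cheeger's inequality bounds the spectral gaps
   from below.  If [pb] is not negligible compared with [pw], the gap of the whole
   graph bounds [x].  Otherwise write [x] as a multiple of the block sign vector plus a
   part with zero mean on each block: testing the equation against both parts and using
   the block gaps gives |x|_2 = O(1/(n(pw+pb)) + 1/(n^(3/2) pb (pw+pb))).
   Conditionally on the graph each entry of [Fdag E] is a sum of independent
   sub-Gaussian variables with weights [x], hence its maximum is
   O(|x|_2 sqrt(log n)), while the sum over edges is O(n^2 pb). *)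

(** * Cheeger's inequality for weighted finite graphs *)

Section Cheeger.
Import mathcomp.boot.fintype mathcomp.boot.finset.
Context {R : realType} {I : finType}.
Implicit Types (S V : {set I}) (w : I -> I -> R).

(** The obstacle is one sparse cut. When [pb] is much smaller than [pw], Cheeger's inequality for
    the whole graph only gives a gap of order n pb^2 / (pw + pb), far below the scale n (pw + pb)
    that is wanted. The single cause is the block sign vector, so that direction is treated by hand:
    its energy is the total weight between the blocks, and only cross-block degrees couple it to the
    rest. The threshold [2048 * k ^+ 3 * pb <= pw] makes this coupling small enough to be absorbed;
    below it, the whole-graph gap loses only a constant factor. Multiplying the bound on |x|_2 by n
    pb, the edge sum divided by n, gives exactly the two terms of the rate, pb / (pw + pb) and 1 /
    (sqrt n (pw + pb)). Conditioning on the graph needs no conditional expectation. [Phi] takes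
    finitely many values and the pseudoinverse is unique, so on each event fixing [Phi] it is a
    constant matrix; bounds of the form P(A and B) <= P(A) y are proved on these events and
    summed. *)

Definition cut_weight w S V : R := \sum_(i in S) \sum_(j in V :\: S) w i j.

Lemma cauchy_schwarz (A : {set I}) (a b : I -> R) :
  (\sum_(i in A) a i * b i) ^+ 2
    <= (\sum_(i in A) a i ^+ 2) * (\sum_(i in A) b i ^+ 2).
Proof.
set p := \sum_(i in A) a i * b i; set q := \sum_(i in A) a i ^+ 2.
set r := \sum_(i in A) b i ^+ 2.
have q0 : 0 <= q by apply: sumr_ge0 => i _; exact: sqr_ge0.
have key x : 0 <= q * x ^+ 2 + 2 * p * x + r.
  have -> : q * x ^+ 2 + 2 * p * x + r = \sum_(i in A) (a i * x + b i) ^+ 2.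
    rewrite /q /r /p mulr_suml mulr_sumr mulr_suml -!big_split /=.
    by apply: eq_bigr => i _; ring.
  by apply: sumr_ge0 => i _; exact: sqr_ge0.
have [q_eq0|qn0] := eqVneq q 0.
  have a0 i : i \in A -> a i = 0.
    move=> iA; apply/eqP; rewrite -sqrf_eq0.
    have /psumr_eq0P : q = 0 by [].
    by move=> /(_ (fun i _ => sqr_ge0 (a i))) -> //.
  have -> : p = 0 by rewrite /p big1// => i iA; rewrite a0// mul0r.
  by rewrite q_eq0 mul0r expr0n.
have qp : 0 < q by rewrite lt_def qn0.
have := key (- p / q).
have -> : q * (- p / q) ^+ 2 + 2 * p * (- p / q) + r = (q * r - p ^+ 2) / q.
  by field.
by rewrite pmulr_lge0 ?invr_gt0// subr_ge0.
Qed.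

(* Peeling off the minimum of [a] on its support reduces the co-area inequality
   to the expansion of that support. *)
Lemma coarea_expansion w V (h : R) (a : I -> R) :
  (forall i j, 0 <= w i j) -> (forall i j, w i j = w j i) ->
  (forall S, S \subset V -> (2 * #|S| <= #|V|)%N -> h * #|S|%:R <= cut_weight w S V) ->
  (forall i, 0 <= a i) -> (2 * #|[set i in V | a i != 0%R]| <= #|V|)%N ->
  2 * h * \sum_(i in V) a i
    <= \sum_(i in V) \sum_(j in V) w i j * `|a i - a j|.
Proof.
move=> w0 wsym hexp; move: {2}_.+1 (ltnSn #|[set i in V | a i != 0%R]|) => n.
elim: n a => // n IH a; rewrite ltnS => leS a0 suppV.
pose S := [set i in V | a i != 0].
have SV : S \subset V by apply/subsetP => i; rewrite inE => /andP[].
have aS i : i \in V -> i \notin S -> a i = 0.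
  by move=> iV; rewrite inE iV/= negbK => /eqP.
have [S0|/set0Pn[i0 i0S]] := eqVneq S set0.
  rewrite big1 ?mulr0; last by move=> i iV; apply: aS; rewrite ?S0 ?inE.
  by apply: sumr_ge0 => i _; apply: sumr_ge0 => j _; rewrite mulr_ge0.
have [k kS kmin] := @arg_minP _ R I i0 (fun i => i \in S) a i0S.
set t := a k.
have tp : 0 < t.
  by move: kS; rewrite inE => /andP[_ ?]; rewrite lt_def a0 andbT.
pose b i := if i \in S then a i - t else a i.
have b0 i : 0 <= b i by rewrite /b; case: ifP => // iS; rewrite subr_ge0 kmin.
pose S' := [set i in V | b i != 0].
have S'S : S' \proper S.
  apply/properP; split.
    apply/subsetP => i; rewrite inE => /andP[iV]; rewrite /b.
    by case: ifP => // iS; rewrite (aS _ iV) ?iS ?eqxx.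
  by exists k => //; rewrite inE /b ifT// subrr eqxx andbF.
have ltS := proper_card S'S.
have {IH} := IH b (leq_trans ltS leS) b0 (leq_trans _ suppV).
rewrite leq_mul2l /= (ltnW ltS) => /(_ isT) IHb.
have cutS := hexp S SV suppV.
have sumE : \sum_(i in V) a i = \sum_(i in V) b i + t * #|S|%:R.
  rewrite mulr_natr -sumr_const (big_setID S)/= [in RHS](big_setID S)/=.
  rewrite (setIidPr SV) addrAC -big_split/=; congr (_ + _).
    by apply: eq_bigr => i iS; rewrite /b iS subrK.
  by apply: eq_bigr => i; rewrite inE => /andP[/negbTE iS _]; rewrite /b iS.
have cut2 : \sum_(i in V) \sum_(j in V) w i j * ((i \in S) (+) (j \in S))%:R
    = 2 * cut_weight w S V.
  rewrite (big_setID S)/= (setIidPr SV) mulrDl mul1r /cut_weight; congr (_ + _).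
    apply: eq_bigr => i iS; rewrite (big_setID S)/= (setIidPr SV) big1 ?add0r.
      by apply: eq_bigr => j; rewrite inE iS => /andP[/negbTE -> _]; rewrite mulr1.
    by move=> j jS; rewrite iS jS mulr0.
  rewrite [RHS]exchange_big/=; apply: eq_bigr => i; rewrite inE => /andP[/negbTE iS iV].
  rewrite (big_setID S)/= (setIidPr SV) [X in _ + X]big1 ?addr0.
    by apply: eq_bigr => j jS; rewrite iS jS mulr1 wsym.
  by move=> j; rewrite inE => /andP[/negbTE jS _]; rewrite iS jS mulr0.
(* Lowering the support by its minimum [t] shortens a difference by exactly [t] on the pairs that
   cross [S], and leaves all other differences unchanged. *)
have dE i j : i \in V -> j \in V ->
    `|a i - a j| = `|b i - b j| + t * ((i \in S) (+) (j \in S))%:R.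
  move=> iV jV; rewrite /b; case: ifPn => iS; case: ifPn => jS /=.
  - by rewrite mulr0 addr0; congr `|_|; ring.
  - rewrite (aS j)// !subr0 mulr1 !ger0_norm ?subrK ?subr_ge0 ?kmin//.
  - rewrite (aS i)// !sub0r !normrN mulr1 !ger0_norm ?subrK ?subr_ge0 ?kmin//.
  - by rewrite mulr0 addr0.
have -> : \sum_(i in V) \sum_(j in V) w i j * `|a i - a j|
   = \sum_(i in V) \sum_(j in V) w i j * `|b i - b j| + t * (2 * cut_weight w S V).
  rewrite -cut2 mulr_sumr -big_split/=; apply: eq_bigr => i iV.
  rewrite mulr_sumr -big_split/=; apply: eq_bigr => j jV.
  by rewrite dE//; ring.
rewrite sumE mulrDr lerD//.
have := ler_wpM2l (ltW tp) cutS; nra.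
Qed.

(** The co-area bound is applied to [g ^+ 2], and |x^2 - y^2| = |x - y| |x + y| is split by a
    weighted arithmetic-geometric inequality, which avoids the square root that Cauchy-Schwarz would
    bring in. *)
Lemma cheeger_nneg w V (h D : R) (g : I -> R) :
  0 < h ->
  (forall i j, 0 <= w i j) -> (forall i j, w i j = w j i) ->
  (forall S, S \subset V -> (2 * #|S| <= #|V|)%N -> h * #|S|%:R <= cut_weight w S V) ->
  (forall i, i \in V -> \sum_(j in V) w i j <= D) ->
  (forall i, 0 <= g i) -> (2 * #|[set i in V | g i != 0%R]| <= #|V|)%N ->
  h ^+ 2 * \sum_(i in V) g i ^+ 2
    <= D * \sum_(i in V) \sum_(j in V) w i j * (g i - g j) ^+ 2.
Proof.
move=> h0 w0 wsym hexp degD g0 suppV.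
have := @coarea_expansion w V h (fun i => g i ^+ 2) w0 wsym hexp (fun i => sqr_ge0 _).
have -> : [set i in V | g i ^+ 2 != 0] = [set i in V | g i != 0].
  by apply/setP => i; rewrite !inE sqrf_eq0.
move=> /(_ suppV); set G := \sum_(i in V) g i ^+ 2; set Q := \sum_(i in V) _.
set Q' := \sum_(i in V) \sum_(j in V) w i j * (g i - g j) ^+ 2 => coar.
have G0 : 0 <= G by apply: sumr_ge0 => i _; exact: sqr_ge0.
have Q'0 : 0 <= Q'.
  by apply: sumr_ge0 => i _; apply: sumr_ge0 => j _; rewrite mulr_ge0// sqr_ge0.
have [GE|Gn0] := eqVneq G 0.
  rewrite GE mulr0; case: (set_0Vmem V) => [V0|[i iV]].
    by rewrite /Q' V0 big_set0 mulr0.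
  by rewrite mulr_ge0// (le_trans _ (degD i iV))// sumr_ge0.
have Gp : 0 < G by rewrite lt_def Gn0.
have Dp : 0 < D.
  have [i iV] : exists i, i \in V.
    by apply/set0Pn; apply: contraNneq Gn0 => V0; rewrite /G V0 big_set0.
  have D0 : 0 <= D by rewrite (le_trans _ (degD i iV))// sumr_ge0.
  (* If [D] were zero, all weights inside [V] would vanish and the co-area bound would force
     [G = 0]. *)
  rewrite lt_def D0 andbT; apply/negP => /eqP DE.
  have wz k l : k \in V -> l \in V -> w k l = 0.
    move=> kV lV; have := degD k kV; rewrite DE => sle.
    have /psumr_eq0P : \sum_(j in V) w k j = 0.
      by apply/eqP; rewrite eq_le sle sumr_ge0.
    by move=> /(_ (fun j _ => w0 k j)) -> //.
  have Q0 : Q = 0.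
    by rewrite /Q big1// => k kV; rewrite big1// => l lV; rewrite wz// mul0r.
  move: coar; rewrite Q0 pmulr_rle0 ?mulr_gt0// => Gle.
  by have := lt_le_trans Gp Gle; rewrite ltxx.
(* This weight makes the (x + y)^2 part contribute exactly [h * G], half of the co-area lower bound
   [2 * h * G]; the other half is what remains. *)
pose th := 2 * D / h.
have thp : 0 < th by rewrite /th divr_gt0 ?mulr_gt0.
have pw x y : `|x ^+ 2 - y ^+ 2| <= th / 2 * (x - y) ^+ 2 + (x + y) ^+ 2 / (2 * th).
  rewrite subr_sqr normrM.
  have := sqr_ge0 (th * `|x - y| - `|x + y|).
  rewrite -(real_normK (num_real (x - y))) -(real_normK (num_real (x + y))) => sq.
  rewrite -(ler_pM2l (mulr_gt0 (ltr0n _ 2) thp)).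
  have -> : 2 * th * (th / 2 * `|x - y| ^+ 2 + `|x + y| ^+ 2 / (2 * th)) =
     th ^+ 2 * `|x - y| ^+ 2 + `|x + y| ^+ 2 by field; rewrite gt_eqF.
  by rewrite -subr_ge0; apply: le_trans sq _; rewrite le_eqVlt; apply/orP; left; apply/eqP; ring.
have sumsq : \sum_(i in V) \sum_(j in V) w i j * (g i + g j) ^+ 2 <= 4 * D * G.
  have : \sum_(i in V) \sum_(j in V) w i j * (g i + g j) ^+ 2 <=
     \sum_(i in V) \sum_(j in V) (2 * (w i j * g i ^+ 2) + 2 * (w i j * g j ^+ 2)).
    apply: ler_sum => i _; apply: ler_sum => j _.
    have := mulr_ge0 (w0 i j) (sqr_ge0 (g i - g j)); nra.
  move=> /le_trans; apply.
  have half : \sum_(i in V) \sum_(j in V) w i j * g i ^+ 2 <= D * G.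
    rewrite /G mulr_sumr; apply: ler_sum => i iV.
    by rewrite -mulr_suml ler_wpM2r ?sqr_ge0// degD.
  have half' : \sum_(i in V) \sum_(j in V) w i j * g j ^+ 2 <= D * G.
    rewrite exchange_big/=; apply: le_trans half.
    by apply: ler_sum => i _; apply: ler_sum => j _; rewrite wsym.
  under eq_bigr do rewrite big_split/= -!mulr_sumr.
  rewrite big_split/= -!mulr_sumr; lra.
have : Q <= th / 2 * Q' + 4 * D * G / (2 * th).
  apply: le_trans (_ : _ <= th / 2 * Q' +
    (\sum_(i in V) \sum_(j in V) w i j * (g i + g j) ^+ 2) / (2 * th)) _.
    rewrite /Q /Q' mulr_sumr mulr_suml -big_split/=; apply: ler_sum => i _.
    rewrite mulr_sumr mulr_suml -big_split/=; apply: ler_sum => j _.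
    have := ler_wpM2l (w0 i j) (pw (g i) (g j)) => /le_trans; apply.
    by rewrite le_eqVlt; apply/orP; left; apply/eqP; ring.
  by rewrite lerD2l ler_wpM2r// invr_ge0 mulr_ge0// ltW.
have -> : th / 2 * Q' + 4 * D * G / (2 * th) = (D * Q' / h) + h * G.
  by rewrite /th; field; rewrite !gt_eqF.
move=> Qle.
have : h * G <= D * Q' / h by have := le_trans coar Qle; lra.
by rewrite ler_pdivlMr// => hh; rewrite expr2; lra.
Qed.

(** Take the least value of [y] with at most half of [V] strictly above it. If more than half lay
    strictly below, the largest value below would qualify too, since the points above it are the
    complement of those below [c]. *)
Lemma median (V : {set I}) (y : I -> R) :
  exists c, (2 * #|[set i in V | (c < y i)%R]| <= #|V|)%N /\
            (2 * #|[set i in V | (y i < c)%R]| <= #|V|)%N.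
Proof.
have [->|/set0Pn[i0 i0V]] := eqVneq V set0.
  have E (Q : pred I) : [set i in set0 | Q i] = set0 by apply/setP => i; rewrite !inE.
  by exists 0; rewrite !E cards0.
pose C := [set i in V | (2 * #|[set j in V | (y i < y j)%R]| <= #|V|)%N].
have [k kV kmax] := @arg_maxP _ R I i0 (fun i => i \in V) y i0V.
have kC : k \in C.
  rewrite inE; apply/andP; split=> //.
  rewrite (_ : [set j in V | _] = set0) ?cards0//; apply/setP => i; rewrite !inE.
  by apply/negbTE/negP => /andP[iV]; rewrite ltNge (kmax i iV : y i <= y k).
have [c cC cmin] := @arg_minP _ R I k (fun i => i \in C) y kC.
exists (y c); split; first by move: cC; rewrite inE => /andP[].
rewrite leqNgt; apply/negP => lowc.
have [i1 i1L] : exists i, i \in [set i in V | y i < y c].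
  apply/set0Pn; apply: contraTneq lowc => ->; by rewrite cards0.
have [l lL lmax] := @arg_maxP _ R I i1 (fun i => i \in [set i in V | y i < y c]) y i1L.
move: (lL); rewrite inE => /andP[lV lc].
suff lC : l \in C by have := cmin l lC; rewrite leNgt lc.
rewrite inE lV/=.
have -> : [set j in V | y l < y j] = V :\: [set i in V | y i < y c].
  apply/setP => j; rewrite !inE; case jV : (j \in V); rewrite ?andbF ?andbT//= -leNgt.
  apply/idP/idP => [|/(lt_le_trans lc)//].
  move=> lj; rewrite leNgt; apply/negP => jc.
  by have := lmax j; rewrite inE jV jc => /(_ isT) h; move: (h : y j <= y l); rewrite leNgt lj.
have sub : [set i in V | y i < y c] \subset V.
  by apply/subsetP => j; rewrite inE => /andP[].
rewrite cardsD (setIidPr sub).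
have := subset_leq_card sub.
move: lowc; set u := #|_|; set v := #|_|; move=> ? ?.
by rewrite mulnBr leq_subLR mul2n -addnn leq_add2r ltnW.
Qed.

Lemma parts (t : R) : (0 <= t /\ Num.max t 0 = t /\ Num.max (- t) 0 = 0) \/
  (t <= 0 /\ Num.max t 0 = 0 /\ Num.max (- t) 0 = - t).
Proof.
case/orP: (le_total 0 t) => t0; [left|right].
  by split=> //; split; [exact: max_l|rewrite max_r// oppr_le0].
by split=> //; split; [exact: max_r|rewrite max_l// oppr_ge0].
Qed.

Lemma sqr_parts (t : R) : t ^+ 2 <= Num.max t 0 ^+ 2 + Num.max (- t) 0 ^+ 2.
Proof. by case: (parts t) => -[_ [-> ->]]; rewrite ?sqrrN expr0n/= ?addr0 ?add0r. Qed.

(** For opposite signs the two sides differ by the cross term -2 s t, which is then nonnegative; for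
    equal signs they agree. *)
Lemma sqr_parts_sub (s t : R) :
  (Num.max s 0 - Num.max t 0) ^+ 2 + (Num.max (- s) 0 - Num.max (- t) 0) ^+ 2
    <= (s - t) ^+ 2.
Proof.
case: (parts s) => -[s0 [-> ->]]; case: (parts t) => -[t0 [-> ->]]; rewrite -subr_ge0.
- by rewrite subrr expr0n/= addr0 subrr.
- have -> : (s - t) ^+ 2 - ((s - 0) ^+ 2 + (0 - - t) ^+ 2) = 2 * (s * - t) by ring.
  by rewrite mulr_ge0// mulr_ge0// oppr_ge0.
- have -> : (s - t) ^+ 2 - ((0 - t) ^+ 2 + (- s - 0) ^+ 2) = 2 * (t * - s) by ring.
  by rewrite mulr_ge0// mulr_ge0// oppr_ge0.
- by have -> : (s - t) ^+ 2 - ((0 - 0) ^+ 2 + (- s - - t) ^+ 2) = 0 by ring.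
Qed.

(** Centring at a median makes the positive and negative parts of [y - c] both supported on at most
    half of [V], as [cheeger_nneg] requires. The shift does not reduce the left side, because a
    function of mean zero has its least sum of squares at shift zero. *)
Lemma cheeger w V (h D : R) (y : I -> R) :
  0 < h ->
  (forall i j, 0 <= w i j) -> (forall i j, w i j = w j i) ->
  (forall S, S \subset V -> (2 * #|S| <= #|V|)%N -> h * #|S|%:R <= cut_weight w S V) ->
  (forall i, i \in V -> \sum_(j in V) w i j <= D) ->
  \sum_(i in V) y i = 0 ->
  h ^+ 2 * \sum_(i in V) y i ^+ 2
    <= D * \sum_(i in V) \sum_(j in V) w i j * (y i - y j) ^+ 2.
Proof.
move=> h0 w0 wsym hexp degD y0.
have [V0|/set0Pn[i0 i0V]] := eqVneq V set0.
  by rewrite V0 !big_set0 !mulr0.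
have D0 : 0 <= D by rewrite (le_trans _ (degD i0 i0V))// sumr_ge0.
have [c [cup clow]] := median V y.
pose gp i := Num.max (y i - c) 0; pose gn i := Num.max (c - y i) 0.
have gp0 i : 0 <= gp i by rewrite le_max lexx orbT.
have gn0 i : 0 <= gn i by rewrite le_max lexx orbT.
have Ep : [set i in V | gp i != 0] = [set i in V | c < y i].
  apply/setP => i; rewrite !inE; congr (_ && _); rewrite /gp.
  case: (ltP c (y i)) => ci.
    by rewrite max_l ?subr_ge0 ?ltW// subr_eq0 gt_eqF.
  by rewrite max_r ?subr_le0// eqxx.
have En : [set i in V | gn i != 0] = [set i in V | y i < c].
  apply/setP => i; rewrite !inE; congr (_ && _); rewrite /gn.
  case: (ltP (y i) c) => ci.
    by rewrite max_l ?subr_ge0 ?ltW// subr_eq0 gt_eqF.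
  by rewrite max_r ?subr_le0// eqxx.
have Hp := cheeger_nneg h0 w0 wsym hexp degD gp0; rewrite Ep in Hp.
have Hn := cheeger_nneg h0 w0 wsym hexp degD gn0; rewrite En in Hn.
have {Hp Hn} := lerD (Hp cup) (Hn clow); rewrite -!mulrDr => H.
apply: le_trans (_ : h ^+ 2 * \sum_(i in V) (y i - c) ^+ 2 <= _).
  rewrite ler_wpM2l ?sqr_ge0//.
  rewrite [leRHS](eq_bigr (fun i => y i ^+ 2 + (c ^+ 2 + - 2 * c * y i))).
    have cy0 : \sum_(i in V) - 2 * c * y i = 0 by rewrite -mulr_sumr y0 mulr0.
    rewrite big_split/= lerDl big_split/= cy0 addr0.
    by apply: sumr_ge0 => i _; exact: sqr_ge0.
  by move=> i _; ring.
apply: le_trans (_ : h ^+ 2 * (\sum_(i in V) gp i ^+ 2 + \sum_(i in V) gn i ^+ 2) <= _).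
  rewrite ler_wpM2l ?sqr_ge0// -big_split/=; apply: ler_sum => i _.
  by rewrite /gp /gn -(opprB (y i)) sqr_parts.
apply: le_trans H _; rewrite ler_wpM2l// -big_split/=; apply: ler_sum => i _.
rewrite -big_split/=; apply: ler_sum => j _; rewrite -mulrDr ler_wpM2l//.
rewrite /gp /gn -(opprB (y i)) -(opprB (y j)).
have -> : y i - y j = (y i - c) - (y j - c) by ring.
exact: sqr_parts_sub.
Qed.

End Cheeger.

(** * Dirichlet forms and the two-block decomposition *)

Section DirichletForm.
Context {R : realType} {I : finType}.
Import mathcomp.boot.fintype mathcomp.boot.finset.
Implicit Types (S V : {set I}) (w : I -> I -> R) (x y z : I -> R).

(** For symmetric [w] this is twice the Laplacian form z^T L x, since ordered pairs count every edge
    twice. Hence the weak form of L x = e_j - e_k reads [dform w z x = 2 * (z j - z k)]. *)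
Definition dform w z x : R := \sum_i \sum_j w i j * ((z i - z j) * (x i - x j)).

Definition norm2 x : R := Num.sqrt (\sum_i x i ^+ 2).

Lemma sqr_norm2 x : norm2 x ^+ 2 = \sum_i x i ^+ 2.
Proof. by rewrite sqr_sqrtr// sumr_ge0// => i _; exact: sqr_ge0. Qed.

Lemma norm2_ge0 x : 0 <= norm2 x.
Proof. exact: sqrtr_ge0. Qed.

Lemma ler_norm2 x i : `|x i| <= norm2 x.
Proof.
rewrite -(@ler_pXn2r _ 2)// ?nnegrE ?norm2_ge0// sqr_norm2 real_normK ?num_real//.
by rewrite (bigD1 i)//= lerDl sumr_ge0// => j _; exact: sqr_ge0.
Qed.

Lemma norm1_le_norm2 x : \sum_i `|x i| <= Num.sqrt #|I|%:R * norm2 x.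
Proof.
rewrite -(@ler_pXn2r _ 2)// ?nnegrE ?mulr_ge0 ?sqrtr_ge0//; last exact: sumr_ge0.
rewrite exprMn sqr_sqrtr ?ler0n// sqr_norm2.
have := @cauchy_schwarz _ _ [set: I] (fun=> 1) (fun i => `|x i|).
have E (f : I -> R) : \sum_(i in [set: I]) f i = \sum_i f i.
  by apply: eq_bigl => i; rewrite inE.
rewrite !E (eq_bigr _ (fun i _ => mul1r `|x i|)).
have -> : \sum_i `|x i| ^+ 2 = \sum_i x i ^+ 2.
  by apply: eq_bigr => i _; rewrite real_normK ?num_real.
have -> : \sum_(i : I) (1 : R) ^+ 2 = #|I|%:R.
  by under eq_bigr do rewrite expr1n; rewrite sumr_const cardT -cardE.
by [].
Qed.

Lemma dformDr w z x y : dform w z (fun i => x i + y i) = dform w z x + dform w z y.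
Proof.
rewrite /dform -big_split/=; apply: eq_bigr => i _.
by rewrite -big_split/=; apply: eq_bigr => j _; ring.
Qed.

Lemma dformZr w z (a : R) x : dform w z (fun i => a * x i) = a * dform w z x.
Proof.
rewrite /dform mulr_sumr; apply: eq_bigr => i _.
by rewrite mulr_sumr; apply: eq_bigr => j _; ring.
Qed.

Lemma dformC w z x : dform w z x = dform w x z.
Proof. by apply: eq_bigr => i _; apply: eq_bigr => j _; rewrite [X in _ * X]mulrC. Qed.

Lemma dform_parts w z x : (forall i j, w i j = w j i) ->
  dform w z x = 2 * \sum_i x i * \sum_j w i j * (z i - z j).
Proof.
move=> wsym; have E : dform w z x = \sum_i \sum_j w i j * (z i - z j) * x i
     - \sum_i \sum_j w i j * (z i - z j) * x j.
  rewrite -sumrB; apply: eq_bigr => i _; rewrite -sumrB; apply: eq_bigr => j _; ring.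
have -> : \sum_i x i * \sum_j w i j * (z i - z j) = \sum_i \sum_j w i j * (z i - z j) * x i.
  by apply: eq_bigr => i _; rewrite mulrC mulr_suml.
rewrite E mulrDl mul1r; congr (_ + _).
rewrite exchange_big/= -sumrN; apply: eq_bigr => i _.
by rewrite -sumrN; apply: eq_bigr => j _; rewrite wsym; ring.
Qed.

(** The equation is tested against [x] itself: lam |x|^2 <= 2 (x_j - x_k) <= 4 |x|. *)
Lemma norm2_gap_bound w (lam : R) x (j k : I) :
  (forall z, dform w z x = 2 * (z j - z k)) ->
  lam * norm2 x ^+ 2 <= dform w x x -> lam * norm2 x <= 4.
Proof.
move=> /(_ x) -> gap; have [->|xn0] := eqVneq (norm2 x) 0; first by rewrite mulr0.
have xp : 0 < norm2 x by rewrite lt_def xn0 norm2_ge0.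
rewrite -(ler_pM2r xp) -mulrA -expr2; apply: le_trans gap _.
have := ler_norm2 x j; have := ler_norm2 x k; rewrite !ler_norml.
move=> /andP[? ?] /andP[? ?]; lra.
Qed.

Section TwoBlocks.
Variables (w : I -> I -> R) (V : {set I}) (m : nat) (lam Db : R).
Hypotheses (m0 : (0 < m)%N) (cV : #|V| = m) (cVc : #|~: V| = m).
Hypotheses (w0 : forall i j, 0 <= w i j) (wsym : forall i j, w i j = w j i).

Definition sgn (i : I) : R := if i \in V then 1 else -1.

Hypothesis gapV : forall y, \sum_(i in V) y i = 0 ->
  lam * \sum_(i in V) y i ^+ 2 <= \sum_(i in V) \sum_(j in V) w i j * (y i - y j) ^+ 2.
Hypothesis gapVc : forall y, \sum_(i in ~: V) y i = 0 ->
  lam * \sum_(i in ~: V) y i ^+ 2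
    <= \sum_(i in ~: V) \sum_(j in ~: V) w i j * (y i - y j) ^+ 2.
Hypothesis degb : forall i, \sum_(j | (i \in V) != (j \in V)) w i j <= Db.

Let M := \sum_(i in V) \sum_(j in ~: V) w i j.

(** Only crossing pairs count, each with (1 - (-1))^2 = 4 and in both orders. *)
Lemma dform_sgn_self : dform w sgn sgn = 8 * M.
Proof.
have -> : dform w sgn sgn =
  \sum_(i in V) \sum_(j in ~: V) 4 * w i j + \sum_(i in ~: V) \sum_(j in V) 4 * w i j.
  rewrite /dform (bigID (mem V))/=; congr (_ + _).
    apply: eq_bigr => i iV; rewrite (bigID (mem V))/= big1 ?add0r.
      by apply: eq_big => j; rewrite ?inE// /sgn iV => /negbTE ->; ring.
    by move=> j jV; rewrite /sgn iV jV; ring.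
  apply: eq_big => i; rewrite ?inE// => /negbTE iV; rewrite (bigID (mem V))/=.
  rewrite [X in _ + X]big1 ?addr0.
    by apply: eq_bigr => j jV; rewrite /sgn iV jV; ring.
  by move=> j /negbTE jV; rewrite /sgn iV jV; ring.
rewrite [X in _ + X]exchange_big/= /M mulr_sumr -big_split/=.
apply: eq_bigr => i _; rewrite mulr_sumr -big_split/=; apply: eq_bigr => j _.
by rewrite [w j i]wsym; ring.
Qed.

(** After summation by parts, the Laplacian of [sgn] at a vertex only sees neighbours in the other
    block. The coupling is therefore controlled by the cross-block degree [Db], not by the full
    degree; the square root comes from comparing the l1 and l2 norms. *)
Lemma dform_sgn_le y : `|dform w sgn y| <= 4 * Db * Num.sqrt #|I|%:R * norm2 y.
Proof.
rewrite dform_parts// normrM ger0_norm// -!mulrA.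
have -> : (4 : R) = 2 * 2 by ring.
rewrite -mulrA ler_pM2l//.
have Db0 : 0 <= Db.
  have /set0Pn[i iV] : V != set0 by rewrite -card_gt0 cV.
  by apply: le_trans (degb i); apply: sumr_ge0.
apply: le_trans (ler_norm_sum _ _ _) _.
apply: le_trans (_ : \sum_i `|y i| * (2 * Db) <= _); last first.
  have -> : 2 * (Db * (Num.sqrt #|I|%:R * norm2 y)) = (Num.sqrt #|I|%:R * norm2 y) * (2 * Db) by ring.
  by rewrite -mulr_suml ler_wpM2r ?norm1_le_norm2// mulr_ge0.
apply: ler_sum => i _; rewrite normrM ler_wpM2l//.
have -> : \sum_j w i j * (sgn i - sgn j) =
    \sum_(j | (i \in V) != (j \in V)) w i j * (sgn i - sgn j).
  rewrite (bigID (fun j => (i \in V) != (j \in V)))/= [X in _ + X]big1 ?addr0//.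
  by move=> j; rewrite negbK /sgn => /eqP ->; rewrite subrr mulr0.
apply: le_trans (ler_norm_sum _ _ _) _.
apply: le_trans (_ : \sum_(j | (i \in V) != (j \in V)) 2 * w i j <= _).
  apply: ler_sum => j _; rewrite normrM ger0_norm// mulrC ler_wpM2r//.
  by rewrite /sgn; case: ifP; case: ifP => _ _; rewrite ler_norml; lra.
by rewrite -mulr_sumr ler_wpM2l.
Qed.

(** The cross-block terms of the form are nonnegative and are dropped; the gaps of the two blocks
    add up. *)
Lemma dform_blocks_gap y : \sum_(i in V) y i = 0 -> \sum_(i in ~: V) y i = 0 ->
  lam * norm2 y ^+ 2 <= dform w y y.
Proof.
move=> yV yVc; rewrite sqr_norm2 (bigID (mem V))/= mulrDr.
have -> : \sum_(i | i \notin V) y i ^+ 2 = \sum_(i in ~: V) y i ^+ 2.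
  by apply: eq_bigl => i; rewrite inE.
apply: le_trans (lerD (gapV yV) (gapVc yVc)) _.
rewrite /dform [leRHS](bigID (mem V))/=; apply: lerD.
  apply: ler_sum => i _; rewrite [leRHS](bigID (mem V))/= -[leLHS]addr0; apply: lerD.
    by apply: ler_sum => j _; rewrite expr2.
  by apply: sumr_ge0 => j _; rewrite mulr_ge0// -expr2 sqr_ge0.
rewrite [leRHS](eq_bigl (fun i => i \in ~: V)); last by move=> i; rewrite inE.
apply: ler_sum => i _; rewrite [leRHS](bigID (mem V))/= -[leLHS]add0r; apply: lerD.
  by apply: sumr_ge0 => j _; rewrite mulr_ge0// -expr2 sqr_ge0.
rewrite [leRHS](eq_bigl (fun i => i \in ~: V)); last by move=> j; rewrite inE.
by apply: ler_sum => j _; rewrite expr2.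
Qed.

(* Split [x] into its component along the block indicator [sgn] and a part [y]
   with zero mean on each block, and test the equation against both. *)
Lemma two_block_split x (j k : I) :
  \sum_i x i = 0 -> (forall z, dform w z x = 2 * (z j - z k)) ->
  exists (al Y : R), [/\ 0 <= Y, 0 <= al,
    norm2 x <= Num.sqrt #|I|%:R * al + Y,
    2 * M * al <= 1 + Db * Num.sqrt #|I|%:R * Y &
    lam * Y <= 4 + 4 * al * Db * Num.sqrt #|I|%:R].
Proof.
move=> x0 eqx; set nu := Num.sqrt #|I|%:R.
have mn0 : m%:R != 0 :> R by rewrite pnatr_eq0 -lt0n.
(* The mean of [x] on [V]. As [x] sums to zero and the blocks have equal size, its mean on the
   complement is [- a]. *)
pose a := (\sum_(i in V) x i) / m%:R.
pose y i := x i - a * sgn i.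
have yV : \sum_(i in V) y i = 0.
  rewrite sumrB [X in _ - X](eq_bigr (fun=> a)); last by move=> i iV; rewrite /sgn iV mulr1.
  by rewrite sumr_const cV -mulr_natr divfK// subrr.
have yVc : \sum_(i in ~: V) y i = 0.
  rewrite sumrB [X in _ - X](eq_bigr (fun=> - a)).
    have : \sum_(i in V) x i + \sum_(i in ~: V) x i = 0.
      rewrite -[RHS]x0 [RHS](bigID (mem V))/=; congr (_ + _).
      by apply: eq_bigl => i; rewrite inE.
    by rewrite sumr_const cVc -mulr_natr mulNr divfK// opprK addrC.
  by move=> i; rewrite inE /sgn => /negbTE ->; rewrite mulrN1.
have xE : x =1 fun i => a * sgn i + y i by move=> i; rewrite /y addrC subrK.
have dx z : dform w z x = a * dform w z sgn + dform w z y.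
  rewrite -dformZr -dformDr; apply: eq_bigr => i _; apply: eq_bigr => l _.
  by rewrite -!xE.
have sgny : \sum_i sgn i * y i = 0.
  rewrite (bigID (mem V))/= (eq_bigr y); last by move=> i iV; rewrite /sgn iV mul1r.
  rewrite yV add0r (eq_big (fun i => i \in ~: V) (fun i => - y i)).
  - by rewrite sumrN yVc oppr0.
  - by move=> i; rewrite inE.
  - by move=> i /negbTE iV; rewrite /sgn iV mulN1r.
have sgn2 i : sgn i ^+ 2 = 1 by rewrite /sgn; case: ifP => _; ring.
have nx : norm2 x ^+ 2 = a ^+ 2 * #|I|%:R + norm2 y ^+ 2.
  rewrite !sqr_norm2 (eq_bigr (fun i => a ^+ 2 + y i ^+ 2 + 2 * a * (sgn i * y i))).
    have sgny2 : \sum_i 2 * a * (sgn i * y i) = 0 by rewrite -mulr_sumr sgny mulr0.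
    by rewrite !big_split/= sgny2 addr0 sumr_const mulr_natr.
  move=> i _; rewrite xE.
  have -> : (a * sgn i + y i) ^+ 2 =
    a ^+ 2 * sgn i ^+ 2 + y i ^+ 2 + 2 * a * (sgn i * y i) by ring.
  by rewrite sgn2 mulr1.
have Y0 := norm2_ge0 y; have nu0 : 0 <= nu := sqrtr_ge0 _.
exists `|a|, (norm2 y); split=> //.
- rewrite -(@ler_pXn2r _ 2)// ?nnegrE ?norm2_ge0 ?addr_ge0 ?mulr_ge0// nx.
  have -> : (nu * `|a| + norm2 y) ^+ 2 =
    nu ^+ 2 * `|a| ^+ 2 + 2 * (nu * `|a| * norm2 y) + norm2 y ^+ 2 by ring.
  have nuE : nu ^+ 2 = #|I|%:R by rewrite sqr_sqrtr ?ler0n.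
  rewrite nuE real_normK ?num_real// [_ * a ^+ 2]mulrC lerD2r lerDl.
  by rewrite !mulr_ge0.
(* Testing against [sgn] gives 8 M |a| <= 4 + 4 Db nu |y|; the claim is this divided by 4. *)
- have := eqx sgn; rewrite dx dform_sgn_self => e1.
  have := dform_sgn_le y; rewrite -/nu => e2.
  have M0 : 0 <= M by apply: sumr_ge0 => i _; apply: sumr_ge0.
  have : `|a * (8 * M)| <= 4 + 4 * Db * nu * norm2 y.
    have -> : a * (8 * M) = 2 * (sgn j - sgn k) - dform w sgn y by rewrite -e1 addrK.
    apply: le_trans (ler_normB _ _) _; apply: lerD => //.
    by rewrite /sgn; case: ifP; case: ifP => _ _; rewrite ler_norml; lra.
  rewrite normrM [`|8 * M|]ger0_norm ?mulr_ge0//; lra.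
(* Testing against [y] yields a bound on [lam * norm2 y ^+ 2], from which one factor [norm2 y] is
   cancelled; hence the separate zero case. *)
- have [->|Yn0] := eqVneq (norm2 y) 0.
    rewrite mulr0 addr_ge0// !mulr_ge0//.
    have /set0Pn[i iV] : V != set0 by rewrite -card_gt0 cV.
    by apply: le_trans (degb i); apply: sumr_ge0.
  have Yp : 0 < norm2 y by rewrite lt_def Yn0.
  rewrite -(ler_pM2r Yp); have -> : lam * norm2 y * norm2 y = lam * norm2 y ^+ 2 by ring.
  apply: le_trans (dform_blocks_gap yV yVc) _.
  have := eqx y; rewrite dx dformC => e1.
  have -> : dform w y y = 2 * (y j - y k) - a * dform w sgn y by rewrite -e1; ring.
  apply: le_trans (ler_norm _) _; apply: le_trans (ler_normB _ _) _.
  rewrite [leRHS]mulrDl; apply: lerD.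
    rewrite normrM ger0_norm//; have := ler_normB (y j) (y k).
    have := ler_norm2 y j; have := ler_norm2 y k; lra.
  rewrite normrM; apply: le_trans (ler_wpM2l (normr_ge0 _) (dform_sgn_le y)) _.
  by rewrite -/nu le_eqVlt; apply/orP; left; apply/eqP; ring.
Qed.

End TwoBlocks.
End DirichletForm.

(** * Rows of the pseudoinverse of an incidence matrix *)

Section Pseudoinverse.
Context {R : realType}.
Import mathcomp.boot.fintype mathcomp.boot.finset.

(** [Fdag] is given outcome by outcome. Uniqueness makes it a function of the graph alone, hence
    constant on every event that fixes [Phi]. *)
Lemma MP_pinv_uniq (m q : nat) (A : 'M[R]_(m, q)) (X Y : 'M[R]_(q, m)) :
  is_MP_pinv A X -> is_MP_pinv A Y -> X = Y.
Proof.
move=> [X1 X2 X3 X4] [Y1 Y2 Y3 Y4].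
have AX : A *m X = A *m Y.
  by rewrite -X3 -{1}Y1 -!mulmxA mulmxA trmx_mul X3 Y3 mulmxA X1.
have XA : X *m A = Y *m A.
  have -> : X *m A = (Y *m A *m (X *m A))^T.
    by rewrite trmx_mul X4 Y4 -mulmxA (mulmxA A) Y1.
  by rewrite -mulmxA (mulmxA A) X1 Y4.
by rewrite -X2 -mulmxA AX mulmxA XA Y2.
Qed.

Lemma sum_sym_offdiag (N : nat) (g : 'I_N -> 'I_N -> R) :
  (forall i j, g i j = g j i) -> (forall i, g i i = 0) ->
  \sum_i \sum_j g i j = 2 * \sum_(e : 'I_N * 'I_N | (e.1 < e.2)%N) g e.1 e.2.
Proof.
move=> gsym gdiag; rewrite pair_bigA/= (bigID (fun e : 'I_N * 'I_N => (e.1 < e.2)%N))/=.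
rewrite mulrDl mul1r; congr (_ + _).
rewrite (bigID (fun e : 'I_N * 'I_N => (e.2 < e.1)%N))/= [X in _ + X]big1 ?addr0.
  rewrite (reindex_inj (h := fun e : 'I_N * 'I_N => (e.2, e.1)))/=; last first.
    by move=> [a b] [c d]/= [-> ->].
  apply: eq_big => [[i j]/=|[i j] _ /=]; last exact: gsym.
  by rewrite -leqNgt andb_idl// => /ltnW.
move=> [i j]/=; rewrite -!leqNgt => /andP[ji ij].
by have -> : i = j; [apply/val_inj/eqP; rewrite eqn_leq ij ji|exact: gdiag].
Qed.

Variables (N : nat) (phi : 'M[R]_N).
Hypotheses (phi01 : forall i j, phi i j = 0 \/ phi i j = 1).
Hypotheses (phisym : forall i j, phi i j = phi j i) (phidiag : forall i, phi i i = 0).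

Lemma mul_row_incidence (z : 'I_N -> R) (c : 'I_#|edges phi|) :
  \sum_v z v * incidence phi v c = z (enum_val c).1 - z (enum_val c).2.
Proof.
have := enum_valP c; rewrite inE => /andP[lt12 /eqP phi1].
have n12 : (enum_val c).2 != (enum_val c).1 by rewrite neq_ltn lt12 orbT.
rewrite (bigD1 (enum_val c).1)//= (bigD1 (enum_val c).2)//= big1.
  by rewrite !mxE/= eqxx (negbTE n12) eqxx phi1 sqrtr1 mulr1 mulrN1 addr0.
by move=> v /andP[/negbTE v1 /negbTE v2]; rewrite !mxE/= v1 v2 mulr0.
Qed.

Lemma sum_edges (g : 'I_N -> 'I_N -> R) :
  \sum_(e in edges phi) g e.1 e.2 =
  \sum_(e : 'I_N * 'I_N | (e.1 < e.2)%N) phi e.1 e.2 * g e.1 e.2.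
Proof.
rewrite [RHS](bigID (fun e : 'I_N * 'I_N => phi e.1 e.2 == 1))/= [X in _ + X]big1 ?addr0.
  apply: eq_big => [e|e]; first by rewrite inE.
  by rewrite inE => /andP[_ /eqP ->]; rewrite mul1r.
move=> e /andP[_]; case: (phi01 e.1 e.2) => ->; rewrite ?mul0r// eqxx//.
Qed.

(** The Penrose identities give X^T = F (X X^T), so each row of [X] is a combination of columns of
    the incidence matrix, and each column sums to zero. *)
Lemma sum_pinv_row (X : 'M[R]_(#|edges phi|, N)) (c : 'I_#|edges phi|) :
  is_MP_pinv (incidence phi) X -> \sum_v X c v = 0.
Proof.
move=> [X1 X2 X3 X4].
have XE : X^T = incidence phi *m (X *m X^T).
  by rewrite -{1}X2 -mulmxA trmx_mul X3 mulmxA.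
have E v : X c v = \sum_e incidence phi v e * (X *m X^T) e c.
  by have /matrixP/(_ v c) := XE; rewrite !mxE.
rewrite (eq_bigr _ (fun v _ => E v)) exchange_big/= big1// => e _.
rewrite -mulr_suml; have := mul_row_incidence (fun=> 1) e.
by rewrite subrr; under eq_bigr do rewrite mul1r; move=> ->; rewrite mul0r.
Qed.

(** Symmetry of X F turns F X F = F into F F^T X^T = F. Since F F^T is the Laplacian, row [c] of [X]
    solves L x = F e_c; no connectedness enters. *)
Lemma dform_pinv_row (X : 'M[R]_(#|edges phi|, N)) (c : 'I_#|edges phi|) :
  is_MP_pinv (incidence phi) X -> forall z : 'I_N -> R,
  dform phi z (X c) = 2 * (z (enum_val c).1 - z (enum_val c).2).
Proof.
move=> [X1 X2 X3 X4] z; set F := incidence phi.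
have FXF : F *m (X *m F)^T = F by rewrite X4 mulmxA X1.
rewrite /dform sum_sym_offdiag; last 2 first.
- by move=> i j; rewrite phisym; ring.
- by move=> i; rewrite phidiag mul0r.
congr (_ * _); rewrite -(sum_edges (fun i j => (z i - z j) * (X c i - X c j))).
rewrite big_enum_val/= -mul_row_incidence -/F.
transitivity (\sum_e (\sum_v z v * F v e) * (X *m F) c e).
  apply: eq_bigr => e _; rewrite mul_row_incidence; congr (_ * _).
  by rewrite mxE -/F mul_row_incidence.
under eq_bigr do rewrite mulr_suml.
rewrite exchange_big/=; apply: eq_bigr => v _.
have -> : F v c = \sum_e F v e * (X *m F)^T e c by rewrite -{1}FXF mxE.
by rewrite mulr_sumr; apply: eq_bigr => e _; rewrite [X in _ = _ * (_ * X)]mxE mulrA.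
Qed.

End Pseudoinverse.

(** * Deterministic bound on graphs with typical cuts and degrees *)

Section GoodGraph.
Context {R : realType}.
Import mathcomp.boot.fintype mathcomp.boot.finset.

(** Each of [al] and [Y] is bounded through the other. Inserting the bound on [al] into that on [Y]
    gives m pw Y <= const + 1024 k^3 m pb Y, and [2048 * k ^+ 3 * pb <= pw] absorbs the last term
    into half of the left side. *)
Lemma two_block_arith (m : nat) (k pw pb M al Y : R) :
  (0 < m)%N -> 1 <= k -> 0 < pw -> 0 < pb -> 2048 * k ^+ 3 * pb <= pw ->
  m%:R ^+ 2 * pb / 4 <= M -> 0 <= al -> 0 <= Y ->
  2 * M * al <= 1 + k * (m%:R * pb) * Num.sqrt (m.*2)%:R * Y ->
  m%:R * pw / (64 * k) * Y <= 4 + 4 * al * (k * (m%:R * pb)) * Num.sqrt (m.*2)%:R ->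
  Num.sqrt (m.*2)%:R * al + Y <=
    (4 * k + 1) * (64 * k * (8 + 32 * k)) / (m%:R * pw)
    + 4 / (m%:R * Num.sqrt m%:R * pb).
Proof.
move=> m0 k1 pw0 pb0 pbw hM al0 Y0; set nu := Num.sqrt _ => e1 e2.
have mp : 1 <= m%:R :> R by rewrite ler1n.
have mp0 : 0 < m%:R :> R by rewrite ltr0n.
have k0 : 0 < k by apply: lt_le_trans k1.
have nu0 : 0 <= nu := sqrtr_ge0 _.
have nu2 : nu ^+ 2 = 2 * m%:R by rewrite sqr_sqrtr ?ler0n// -mul2n natrM.
set r := Num.sqrt m%:R.
have r0 : 0 < r by rewrite sqrtr_gt0.
have r2 : r ^+ 2 = m%:R by rewrite sqr_sqrtr// ltW.
have nur : nu <= 2 * r.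
  by rewrite -(@ler_pXn2r _ 2)// ?nnegrE ?mulr_ge0 ?(ltW r0)// nu2 exprMn r2; lra.
have r1 : 1 <= r by rewrite -(@ler_pXn2r _ 2)// ?nnegrE ?(ltW r0)// r2 expr1n.
have num : nu <= 2 * m%:R by apply: le_trans nur _; rewrite -r2 expr2; nra.
have a1 : m%:R ^+ 2 * pb * al <= 2 + 2 * k * (m%:R * pb) * nu * Y.
  have := ler_wpM2r al0 hM; lra.
have a2 : nu * (m%:R ^+ 2 * pb * al) <= 2 * nu + 4 * k * m%:R ^+ 2 * pb * Y.
  apply: le_trans (ler_wpM2l nu0 a1) _.
  have -> : nu * (2 + 2 * k * (m%:R * pb) * nu * Y) =
     2 * nu + 2 * k * (m%:R * pb) * nu ^+ 2 * Y by ring.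
  by rewrite nu2 lerD2l le_eqVlt; apply/orP; left; apply/eqP; ring.
have a3 : nu * (m%:R * pb * al) <= 4 + 4 * k * m%:R * pb * Y.
  rewrite -(ler_pM2l mp0).
  have -> : m%:R * (nu * (m%:R * pb * al)) = nu * (m%:R ^+ 2 * pb * al) by ring.
  apply: le_trans a2 _.
  have -> : m%:R * (4 + 4 * k * m%:R * pb * Y) =
     4 * m%:R + 4 * k * m%:R ^+ 2 * pb * Y by ring.
  rewrite lerD2r; lra.
have P0 : 0 < m%:R * pw by rewrite mulr_gt0.
have a4 : Y <= 64 * k * (8 + 32 * k) / (m%:R * pw).
  rewrite ler_pdivlMr// mulrC.
  have b1 : 2048 * k ^+ 3 * (m%:R * pb * Y) <= m%:R * pw * Y.
    have := ler_wpM2l (mulr_ge0 (ltW mp0) Y0) pbw; lra.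
  have b2 := ler_wpM2l (ltW k0) a3.
  have b3 : m%:R * pw / (64 * k) * Y <= 4 + 16 * k + 16 * k ^+ 2 * (m%:R * pb * Y).
    apply: le_trans e2 _; lra.
  have k64 : 0 < 64 * k by rewrite mulr_gt0.
  have b4 : m%:R * pw * Y <= 64 * k * (4 + 16 * k) + 1024 * k ^+ 3 * (m%:R * pb * Y).
    have := ler_wpM2l (ltW k64) b3.
    have -> : 64 * k * (m%:R * pw / (64 * k) * Y) = m%:R * pw * Y.
      by field; rewrite gt_eqF.
    lra.
  lra.
have a5 : nu * al <= 4 / (m%:R * r * pb) + 4 * k * Y.
  have -> : 4 / (m%:R * r * pb) + 4 * k * Y = (4 * r + 4 * k * m%:R ^+ 2 * pb * Y) / (m%:R ^+ 2 * pb).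
    by rewrite -r2; field; rewrite !gt_eqF.
  rewrite ler_pdivlMr ?mulr_gt0 ?exprn_gt0//; lra.
have := ler_wpM2l (ltW (mulr_gt0 (ltr0n R 4) k0)) a4; lra.
Qed.

(** If [pw] is at most a constant multiple of [pb], then so is [pw + pb], and the Cheeger gap of the
    whole graph, of order m pb^2 / (pw + pb), is comparable to m (pw + pb). *)
Lemma expander_arith (m : nat) (k pw pb X : R) :
  (0 < m)%N -> 1 <= k -> 0 < pw -> 0 < pb -> pw <= 2048 * k ^+ 3 * pb -> 0 <= X ->
  (m%:R * pb / 8) ^+ 2 / (k * (m%:R * (pw + pb))) * X <= 4 ->
  X <= 256 * k * (1 + 2048 * k ^+ 3) ^+ 2 / (m%:R * (pw + pb)).
Proof.
move=> m0 k1 pw0 pb0; set c := 2048 * k ^+ 3 => pbw X0.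
have mp0 : 0 < m%:R :> R by rewrite ltr0n.
have k0 : 0 < k by apply: lt_le_trans k1.
have c0 : 0 < c by apply: mulr_gt0; [rewrite ltr0n|exact: exprn_gt0].
have s0 : 0 < pw + pb by rewrite addr_gt0.
have sc : pw + pb <= (1 + c) * pb by lra.
rewrite ler_pdivlMr ?mulr_gt0//.
have -> : (m%:R * pb / 8) ^+ 2 / (k * (m%:R * (pw + pb))) * X =
  (m%:R * pb ^+ 2 * X) / (64 * k * (pw + pb)) by field; rewrite !gt_eqF.
rewrite ler_pdivrMr ?mulr_gt0// => e.
have sq : (pw + pb) ^+ 2 <= (1 + c) ^+ 2 * pb ^+ 2.
  by rewrite -exprMn ler_pXn2r// nnegrE ?(ltW s0)// mulr_ge0 ?ltW// addr_gt0.
rewrite -(ler_pM2r s0).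
have -> : X * (m%:R * (pw + pb)) * (pw + pb) = (m%:R * X) * (pw + pb) ^+ 2 by ring.
apply: le_trans (ler_wpM2l (mulr_ge0 (ltW mp0) X0) sq) _.
have := ler_wpM2l (sqr_ge0 (1 + c)) e; lra.
Qed.

(** A set of at most half the vertices has expected cut at least m p / 2 per vertex, and the lower
    Chernoff bound keeps a quarter of it: hence 1/8, and 1/4 for the total weight between the
    blocks. The degree slack [k] is later [expR 1], from the upper Chernoff bound. *)
Definition good_graph {I : finType} (w : I -> I -> R) (V : {set I}) (k pw pb : R) : Prop :=
  let m := #|V|%:R in
  [/\ (forall S : {set I}, S \subset V -> (2 * #|S| <= #|V|)%N ->
         m * pw / 8 * #|S|%:R <= cut_weight w S V) /\
      (forall S : {set I}, S \subset ~: V -> (2 * #|S| <= #|~: V|)%N ->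
         m * pw / 8 * #|S|%:R <= cut_weight w S (~: V)),
      (forall S : {set I}, (2 * #|S| <= #|I|)%N ->
         m * pb / 8 * #|S|%:R <= cut_weight w S setT),
      (forall i, \sum_(j | (i \in V) == (j \in V)) w i j <= k * (m * pw)),
      (forall i, \sum_(j | (i \in V) != (j \in V)) w i j <= k * (m * pb)) &
      m ^+ 2 * pb / 4 <= \sum_(i in V) \sum_(j in ~: V) w i j].

(* If [pw] dominates, [x] is controlled by the block decomposition; otherwise the
   whole graph is an expander at scale [pb]. *)
Lemma good_graph_norm2 (k : R) : 1 <= k -> exists C : R, 0 < C /\
  forall (I : finType) (w : I -> I -> R) (V : {set I}) (pw pb : R) (x : I -> R) (j l : I),
  (0 < #|V|)%N -> #|~: V| = #|V| -> 0 < pw -> pw <= 1 -> 0 < pb -> pb <= 1 ->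
  (forall i j, 0 <= w i j) -> (forall i j, w i j = w j i) ->
  good_graph w V k pw pb -> \sum_i x i = 0 ->
  (forall z, dform w z x = 2 * (z j - z l)) ->
  norm2 x <= C * (1 / (#|V|%:R * (pw + pb))
                + 1 / (#|V|%:R * Num.sqrt #|V|%:R * pb * (pw + pb))).
Proof.
move=> k1; pose c := 2048 * k ^+ 3.
have k0 : 0 < k by apply: lt_le_trans k1.
have c0 : 0 < c by apply: mulr_gt0; [rewrite ltr0n|exact: exprn_gt0].
pose C1 := (4 * k + 1) * (64 * k * (8 + 32 * k)).
have C10 : 0 < C1 by rewrite !(mulr_gt0, addr_gt0).
pose C2 := 256 * k * (1 + c) ^+ 2.
have C20 : 0 < C2.
  apply: mulr_gt0; last by rewrite exprn_gt0// addr_gt0.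
  by apply: mulr_gt0; [rewrite ltr0n|].
exists (2 * C1 + C2 + 8); split; first by rewrite !addr_gt0// mulr_gt0.
move=> I w V pw pb x j l V0 cVc pw0 pw1 pb0 pb1 w0 wsym
  [[cutV cutVc] cutT degV degb hM] x0 eqx.
have mp0 : 0 < #|V|%:R :> R by rewrite ltr0n.
have mpw : 0 < #|V|%:R * pw / 8 by rewrite divr_gt0// mulr_gt0.
have mpb : 0 < #|V|%:R * pb / 8 by rewrite divr_gt0// mulr_gt0.
have s0 : 0 < pw + pb by rewrite addr_gt0.
have sq0 : 0 < Num.sqrt #|V|%:R :> R by rewrite sqrtr_gt0.
have cI : #|I| = #|V|.*2 by rewrite -(cardsC V) cVc addnn.
set u := 1 / (#|V|%:R * (pw + pb)); set v := 1 / (_ * _ * pb * _).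
have u0 : 0 < u by rewrite divr_gt0// mulr_gt0.
have v0 : 0 < v by rewrite divr_gt0// !mulr_gt0.
have gap (B : {set I}) (h D : R) (y : I -> R) : 0 < h -> 0 < D ->
    (forall S : {set I}, S \subset B -> (2 * #|S| <= #|B|)%N -> h * #|S|%:R <= cut_weight w S B) ->
    (forall i, i \in B -> \sum_(j in B) w i j <= D) -> \sum_(i in B) y i = 0 ->
    h ^+ 2 / D * \sum_(i in B) y i ^+ 2 <= \sum_(i in B) \sum_(j in B) w i j * (y i - y j) ^+ 2.
  move=> h0 D0 hcut hdeg y0.
  by rewrite mulrAC ler_pdivrMr// [leRHS]mulrC; apply: cheeger.
have [pbw|pbw] := leP (c * pb) pw.
  (* The block gap h^2 / D for expansion h = m pw / 8 and within-block degree D = k m pw. *)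
  have lamE : (#|V|%:R * pw / 8) ^+ 2 / (k * (#|V|%:R * pw)) = #|V|%:R * pw / (64 * k).
    by field; rewrite !gt_eqF.
  have [||al [Y [Y0 al0 nx e1 e2]]] :=
    @two_block_split R I w V #|V| (#|V|%:R * pw / (64 * k)) (k * (#|V|%:R * pb))
      V0 erefl cVc w0 wsym _ _ degb x j l x0 eqx.
  - move=> y; rewrite -lamE; apply: gap => //; first by rewrite !mulr_gt0.
    move=> i iV; apply: le_trans (degV i); rewrite le_eqVlt; apply/orP; left.
    by apply/eqP; apply: eq_bigl => q; rewrite iV; case: (q \in V).
  - move=> y; rewrite -lamE; apply: gap => //; first by rewrite !mulr_gt0.
    move=> i; rewrite inE => /negbTE iV.
    apply: le_trans (degV i); rewrite le_eqVlt; apply/orP; left.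
    by apply/eqP; apply: eq_bigl => q; rewrite inE iV; case: (q \in V).
  apply: le_trans nx _; rewrite cI in e1 e2 *.
  apply: le_trans (two_block_arith V0 k1 pw0 pb0 pbw hM al0 Y0 e1 e2) _.
  rewrite -/C1.
  have c1 : 1 <= c.
    have : 1 <= k ^+ 3 by rewrite exprn_ege1.
    by rewrite /c; lra.
  (* In this case [pb <= pw], so [pw] and [pw + pb] agree up to a factor 2. *)
  have t1 : C1 / (#|V|%:R * pw) <= 2 * C1 * u.
    rewrite /u mul1r ler_pdivrMr ?mulr_gt0//.
    have -> : 2 * C1 / (#|V|%:R * (pw + pb)) * (#|V|%:R * pw) = C1 * (2 * pw / (pw + pb)).
      by field; rewrite !gt_eqF.
    rewrite -[leLHS]mulr1 ler_pM2l// ler_pdivlMr// mul1r.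
    have : 0 <= (c - 1) * pb by rewrite mulr_ge0 ?subr_ge0 ?(ltW pb0).
    lra.
  (* The factor 1 / (pw + pb) in the second term of the rate enters here, through [pw + pb <= 2]. *)
  have t2 : 4 / (#|V|%:R * Num.sqrt #|V|%:R * pb) <= 8 * v.
    rewrite ler_pdivrMr ?mulr_gt0//.
    have -> : 8 * v * (#|V|%:R * Num.sqrt #|V|%:R * pb) = 8 / (pw + pb).
      by rewrite /v; field; rewrite !gt_eqF.
    by rewrite ler_pdivlMr//; lra.
  have := mulr_gt0 C10 v0; have := mulr_gt0 C20 v0; have := mulr_gt0 C20 u0; lra.
have Dp : 0 < k * (#|V|%:R * (pw + pb)) by rewrite !mulr_gt0.
have gT : (#|V|%:R * pb / 8) ^+ 2 / (k * (#|V|%:R * (pw + pb))) * norm2 x ^+ 2 <= dform w x x.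
  have sT (f : I -> R) : \sum_(i in [set: I]) f i = \sum_i f i.
    by apply: eq_bigl => i; rewrite inE.
  rewrite sqr_norm2 -sT; have := @gap setT (#|V|%:R * pb / 8) (k * (#|V|%:R * (pw + pb))) x mpb Dp.
  rewrite !sT => g; apply: le_trans (g _ _ x0) _.
  - by move=> S _; rewrite cardsT; exact: cutT.
  - move=> i _; rewrite sT (bigID (fun q => (i \in V) == (q \in V)))/=.
    by have := lerD (degV i) (degb i); rewrite -mulrDr -mulrDr.
  - rewrite le_eqVlt; apply/orP; left; apply/eqP; apply: eq_bigr => i _.
    by rewrite sT; apply: eq_bigr => q _; rewrite expr2.
have := norm2_gap_bound eqx gT.
move=> /(expander_arith V0 k1 pw0 pb0 (ltW pbw) (norm2_ge0 x)).
rewrite -/c -/C2 => h; apply: le_trans h _.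
have -> : C2 / (#|V|%:R * (pw + pb)) = C2 * u by rewrite /u mul1r.
have := mulr_gt0 C10 v0; have := mulr_gt0 C20 v0; have := mulr_gt0 C10 u0; lra.
Qed.

End GoodGraph.

Local Open Scope classical_set_scope.

(** * Factorisation of integrals of independent variables *)

Section IndependentIntegral.
Import HBNNSimple.
Context {R : realType} {d : measure_display} {T : measurableType d}.
Variable P : probability T R.
Implicit Types (h Y : T -> R) (g : R -> R).

(** The coefficient [Num.max z 0] equals [z] on the range of [f] and is nonnegative for every real
    [z], so that the sum and the integral can be exchanged without a membership condition. *)
Lemma integral_mul_nnsfun h Y (f : {nnsfun R >-> R}) :
  measurable_fun setT h -> (forall w, 0 <= h w) -> measurable_fun setT Y ->
  (\int[P]_w (h w * f (Y w))%:E =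
   \sum_(z <- finmap.enum_fset (fset_set (range f))) (Num.max z 0)%:E *
     \int[P]_w (h w * \1_(f @^-1` [set z]) (Y w))%:E)%E.
Proof.
move=> mh h0 mY.
have mI z : measurable_fun setT (fun w => \1_(f @^-1` [set z]) (Y w) : R).
  by apply: measurableT_comp => //; exact: measurable_indic.
have z0 (z : R) : 0 <= Num.max z 0 by rewrite le_max lexx orbT.
under eq_integral => w _.
  rewrite (_ : (h w * f (Y w))%:E = \sum_(z <- finmap.enum_fset (fset_set (range f)))
     (Num.max z 0)%:E * (h w * \1_(f @^-1` [set z]) (Y w))%:E)%E; first over.
  under [RHS]eq_bigr do rewrite -EFinM.
  rewrite sumEFin; congr EFin.
  rewrite {1}fimfunE fsbig_finite//= mulr_sumr; apply: eq_big_seq => z.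
  rewrite in_fset_set// inE => -[y _ <-]; rewrite max_l//; ring.
rewrite ge0_integral_sum//.
- apply: eq_bigr => z _; rewrite ge0_integralZl_EFin//.
    by move=> w _; rewrite lee_fin mulr_ge0.
  by apply/measurable_EFinP; exact: measurable_funM.
- move=> z; apply/measurable_EFinP; apply: measurable_funM => //.
  exact: measurable_funM.
- by move=> z w _; rewrite mule_ge0 ?lee_fin// mulr_ge0.
Qed.

(** Monotone convergence carries the factorisation from indicators to simple functions and then to
    nonnegative measurable [g]. *)
Lemma integral_mul_indep h Y (c : R) g :
  measurable_fun setT h -> (forall w, 0 <= h w) -> measurable_fun setT Y ->
  measurable_fun setT g -> (forall y, 0 <= g y) ->
  (forall B, measurable B ->
     \int[P]_w (h w * \1_B (Y w))%:E = c%:E * \int[P]_w (\1_B (Y w))%:E)%E ->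
  (\int[P]_w (h w * g (Y w))%:E = c%:E * \int[P]_w (g (Y w))%:E)%E.
Proof.
move=> mh h0 mY mg g0 H.
have mg' : measurable_fun setT (EFin \o g) by apply/measurable_EFinP.
pose gn := nnsfun_approx measurableT mg'.
have gn_cvg y : (EFin \o gn ^~ y) @ \oo --> (g y)%:E.
  by apply: cvg_nnsfun_approx => // x _; rewrite lee_fin.
have gn_nd y : {homo gn ^~ y : n m / (n <= m)%N >-> n <= m}.
  by move=> n m nm; have /lefP := nd_nnsfun_approx measurableT mg' nm; apply.
have mgn n : measurable_fun setT (fun w => gn n (Y w)).
  by apply: measurableT_comp => //.
have gn0 n y : 0 <= gn n y by [].
have stepH n : (\int[P]_w (h w * gn n (Y w))%:E = c%:E * \int[P]_w (gn n (Y w))%:E)%E.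
  rewrite integral_mul_nnsfun//.
  have := @integral_mul_nnsfun (cst 1) Y (gn n) (measurable_cst _) (fun=> ler01) mY.
  under eq_integral do rewrite mul1r.
  move=> ->; rewrite ge0_sume_distrr; last first.
    move=> z _; rewrite mule_ge0 ?lee_fin// ?le_max ?lexx ?orbT//.
    by apply: integral_ge0 => w _; rewrite lee_fin mul1r.
  apply: eq_bigr => z _; rewrite H; last exact: measurable_funPTI.
  by under [in RHS]eq_integral do rewrite mul1r; rewrite muleCA.
have limE (k : T -> R) : measurable_fun setT k -> (forall w, 0 <= k w) ->
    (\int[P]_w (k w * gn n (Y w))%:E)%E @[n --> \oo] --> (\int[P]_w (k w * g (Y w))%:E)%E.
  move=> mk k0.
  have := @cvg_monotone_convergence _ _ _ P setT measurableT
    (fun n w => (k w * gn n (Y w))%:E).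
  rewrite (_ : (fun x => limn _) = (fun w => (k w * g (Y w))%:E)).
    apply.
    - by move=> n; apply/measurable_EFinP; exact: measurable_funM.
    - by move=> n w _; rewrite lee_fin mulr_ge0.
    - by move=> w _ n m nm; rewrite lee_fin ler_wpM2l// gn_nd.
  apply/funext => w; apply/cvg_lim => //.
  by under eq_fun do rewrite EFinM; rewrite EFinM; apply: cvgeZl => //; exact: gn_cvg.
have L1 := limE h mh h0.
have L2 : (\int[P]_w (gn n (Y w))%:E)%E @[n --> \oo] --> (\int[P]_w (g (Y w))%:E)%E.
  have := limE (cst 1) (measurable_cst _) (fun=> ler01).
  under eq_fun do under eq_integral do rewrite mul1r.
  by under eq_integral do rewrite mul1r.
apply: (cvg_unique _ L1) => //.
rewrite (_ : (fun n => _) = (fun n => c%:E * \int[P]_w (gn n (Y w))%:E)%E).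
  exact: cvgeZl.
by apply/funext => n; exact: stepH.
Qed.

(** The event [A] plays the part of conditioning: it will fix the graph while the [X i] are noise
    entries. Independence is only given on rectangles, and the factors are released from indicators
    to general functions one index at a time. *)
Lemma integral_prod_indep {I : finType} (X : I -> T -> R) (A : set T) (a : R) :
  measurable A -> P A = a%:E -> (forall i, measurable_fun setT (X i)) ->
  (forall B : I -> set R, (forall i, measurable (B i)) ->
     P (A `&` [set w | forall i, B i (X i w)]) =
       (P A * \prod_i P (X i @^-1` B i))%E) ->
  forall (f : I -> R -> R) (m : I -> R),
  (forall i, measurable_fun setT (f i)) -> (forall i y, 0 <= f i y) ->
  (forall i, \int[P]_w (f i (X i w))%:E = (m i)%:E)%E ->
  (\int[P]_w (\1_A w * \prod_i f i (X i w))%:E = (a * \prod_i m i)%:E)%E.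
Proof.
move=> mA PA mX indep f m mf f0 intf.
(* Induction on the list of indices whose factor is arbitrary; outside it the factors are
   indicators. The empty list is the independence hypothesis itself. *)
suff C (s : seq I) : uniq s -> forall (f : I -> R -> R) (m : I -> R),
  (forall i, measurable_fun setT (f i)) -> (forall i y, 0 <= f i y) ->
  (forall i, \int[P]_w (f i (X i w))%:E = (m i)%:E)%E ->
  (forall i, i \notin s -> exists2 B, measurable B & f i = \1_B) ->
  (\int[P]_w (\1_A w * \prod_i f i (X i w))%:E = (a * \prod_i m i)%:E)%E.
  by apply: (C (enum I)) => // [|i]; rewrite ?enum_uniq// mem_enum.
elim: s => [_|i0 s IH /= /andP[i0s us]] {mf f0 intf}f {}m mf f0 intf find.
  have [B HB] : {B : I -> set R & forall i, measurable (B i) /\ f i = \1_(B i)}.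
    by apply: (@choice _ _ (fun i B => measurable B /\ f i = \1_B)) => i;
      have [//|B mB fB] := find i; exists B.
  have mXB i : measurable (X i @^-1` B i).
    by rewrite -[X in measurable X]setTI; apply: mX => //; apply: (HB i).1.
  have -> : (fun w => (\1_A w * \prod_i f i (X i w))%:E) =
      (fun w => (\1_(A `&` [set w | forall i, B i (X i w)]) w)%:E).
    apply/funext => w; congr EFin.
    rewrite indicI/=; congr (_ * _); rewrite indicE.
    case: (boolP (w \in _)) => /=.
      rewrite inE/= => wB; rewrite big1// => i _; rewrite (HB i).2 indicE mem_set//.
    move=> /negP; rewrite inE/= => /existsNP[i nB].
    by rewrite (bigD1 i)//= (HB i).2 indicE memNset// mul0r.
  rewrite integral_indic//; last first.
    apply: measurableI => //.
    rewrite (_ : [set w | _] = \bigcap_(i in [set: I]) (X i @^-1` B i)); last first.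
      by apply/seteqP; split => w /=; [move=> h i _; exact: h|move=> h i; exact: h].
    by apply: fin_bigcap_measurable => // i _.
  rewrite setIT; apply: etrans (indep B _) _; first by move=> i; exact: (HB i).1.
  rewrite PA EFinM -prodEFin; congr (_ * _)%E; apply: eq_bigr => i _.
  rewrite -intf (HB i).2.
  have -> : (fun w => (\1_(B i) (X i w))%:E) = (fun w => (\1_(X i @^-1` B i) w)%:E :> \bar R).
    by apply/funext => w; rewrite !indicE.
  by rewrite integral_indic// setIT.
pose h w := \1_A w * \prod_(i | i != i0) f i (X i w).
have mh : measurable_fun setT h.
  apply: measurable_funM; first exact: measurable_indic.
  rewrite (_ : (fun w => _) = (fun w => \prod_(i <- [seq i <- index_enum I | i != i0]) f i (X i w))).
    by apply: measurable_prod => i _; exact: measurableT_comp.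
  by apply/funext => w; rewrite big_filter.
have h0 w : 0 <= h w by rewrite mulr_ge0// prodr_ge0.
pose c := a * \prod_(i | i != i0) m i.
have key : (\int[P]_w (h w * f i0 (X i0 w))%:E = c%:E * \int[P]_w (f i0 (X i0 w))%:E)%E.
  apply: integral_mul_indep => // B mB.
  have mXB : measurable (X i0 @^-1` B).
    by rewrite -[X in measurable X]setTI; apply: mX.
  have PB : (\int[P]_w (\1_B (X i0 w))%:E)%E = (fine (P (X i0 @^-1` B)))%:E.
    have -> : (fun w => (\1_B (X i0 w))%:E) = (fun w => (\1_(X i0 @^-1` B) w)%:E :> \bar R).
      by apply/funext => w; rewrite !indicE.
    by rewrite integral_indic// setIT fineK// fin_num_measure.
  (* With an indicator at [i0] the induction hypothesis applies, which is the premise on indicators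
     that [integral_mul_indep] asks for. *)
  pose f' i := if i == i0 then \1_B else f i.
  pose m' i := if i == i0 then fine (P (X i0 @^-1` B)) else m i.
  have := IH us f' m'.
  have -> : (fun w => (\1_A w * \prod_i f' i (X i w))%:E) =
            (fun w => (h w * \1_B (X i0 w))%:E).
    apply/funext => w; congr EFin; rewrite (bigD1 i0)//= /f' eqxx /h.
    rewrite (eq_bigr (fun i => f i (X i w))); last by move=> i /negbTE ->.
    by rewrite mulrCA mulrC.
  move=> ->.
  - rewrite PB -EFinM; congr EFin; rewrite (bigD1 i0)//= /m' eqxx /c.
    rewrite (eq_bigr m); last by move=> i /negbTE ->.
    by rewrite mulrCA mulrC.
  - by move=> i; rewrite /f'; case: eqP => // _; exact: measurable_indic.
  - by move=> i y; rewrite /f'; case: eqP.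
  - by move=> i; rewrite /f' /m'; case: eqP => // ->.
  - move=> i ins; rewrite /f'; case: eqP => [_|/eqP ii0]; first by exists B.
    by apply: find; rewrite inE negb_or ii0.
have -> : (fun w => (\1_A w * \prod_i f i (X i w))%:E) =
          (fun w => (h w * f i0 (X i0 w))%:E).
  by apply/funext => w; congr EFin; rewrite (bigD1 i0)//= /h mulrCA mulrC.
by rewrite key intf -EFinM; congr EFin; rewrite /c [in RHS](bigD1 i0)//= mulrCA mulrC.
Qed.

End IndependentIntegral.

(** * Chernoff and sub-Gaussian tail bounds *)

Section Tails.
Context {R : realType} {d : measure_display} {T : measurableType d}.
Variable P : probability T R.

Lemma union_bound {I : finType} (A : set T) (B : I -> set T) (x : I -> R) :
  measurable A -> (forall i, measurable (B i)) ->
  (forall w, A w -> exists i, B i w) ->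
  (forall i, P (B i) <= (x i)%:E)%E -> (P A <= (\sum_i x i)%:E)%E.
Proof.
move=> mA mB sub Bx.
have subD : A `<=` \bigcup_(i in [set` index_enum I]) B i.
  by move=> w /sub[i Bi]; exists i => //=; rewrite mem_index_enum.
apply: le_trans (content_sub_fsum P finite_finset (fun i _ => mB i) mA subD) _.
rewrite -fsbig_seq ?index_enum_uniq// -sumEFin; by apply: lee_sum => i _; exact: Bx.
Qed.

Lemma exp_markov (A : set T) (Z : T -> R) (t : R) :
  measurable A -> measurable_fun setT Z ->
  (P (A `&` [set w | (t <= Z w)%R]) <=
     (expR (- t))%:E * \int[P]_w (\1_A w * expR (Z w))%:E)%E.
Proof.
move=> mA mZ.
have mS : measurable [set w | (t <= Z w)%R].
  by rewrite -[X in measurable X]setTI; exact: measurable_fun_le.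
have mE : measurable_fun setT (fun w => \1_A w * expR (Z w)).
  by apply: measurable_funM; [exact: measurable_indic|exact: measurableT_comp].
have E0 w : setT w -> (0%:E <= (\1_A w * expR (Z w))%:E)%E.
  by move=> _; rewrite lee_fin mulr_ge0 ?expR_ge0.
have mE' : measurable_fun setT (fun w => (\1_A w * expR (Z w))%:E) by exact/measurable_EFinP.
rewrite -(ge0_integralZl_EFin P measurableT E0 mE' (expR_ge0 _)).
rewrite -[X in (P X <= _)%E]setIT -integral_indic//; last exact: measurableI.
apply: ge0_le_integral => //.
- exact/measurable_EFinP/measurable_indic/measurableI.
- apply/measurable_EFinP; exact: measurable_funM.
move=> w _; rewrite -EFinM lee_fin indicI/= mulrCA ler_wpM2l//.
rewrite indicE -expRD; case: (boolP (w \in _)) => [|_]; last exact: expR_ge0.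
by rewrite inE/= => tZ; rewrite -expR0 ler_expR addrC subr_ge0.
Qed.

Lemma exp_markovT (Z : T -> R) (t : R) : measurable_fun setT Z ->
  (P [set w | (t <= Z w)%R] <= (expR (- t))%:E * \int[P]_w (expR (Z w))%:E)%E.
Proof.
move=> mZ; have := exp_markov t measurableT mZ; rewrite setTI.
by under eq_integral do rewrite indicT [cst 1 _ * _]mul1r.
Qed.

Lemma expR1_ge2 : 2 <= expR 1 :> R.
Proof. by have := expR_ge1Dx (1 : R); lra. Qed.

Lemma expRN1_le : expR (-1) <= 1 / 2 :> R.
Proof.
rewrite expRN div1r lef_pV2 ?posrE ?expR_gt0//; exact: expR1_ge2.
Qed.

Section Chernoff.
Context {I : finType}.
Variables (X : I -> T -> R) (q : I -> R) (b : pred I).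
Hypotheses (mX : forall i, measurable_fun setT (X i)).
Hypothesis X01 : forall i w, X i w = 0 \/ X i w = 1.
Hypothesis indep : forall B : I -> set R, (forall i, measurable (B i)) ->
  P [set w | forall i, B i (X i w)] = (\prod_i P (X i @^-1` B i))%E.
Hypothesis PX : forall i, P [set w | X i w = 1] = (q i)%:E.

Lemma integral_expR_bernoulli (s : R) (i : I) :
  (\int[P]_w (expR (s * X i w))%:E = (1 + (expR s - 1) * q i)%:E)%E.
Proof.
have mS (x : R) : measurable [set w | X i w = x].
  by have := mX i measurableT (measurable_set1 x); rewrite setTI.
have P0 : P [set w | X i w = 0] = (1 - q i)%:E.
  have -> : [set w | X i w = 0] = ~` [set w | X i w = 1].
    apply/seteqP; split => w /=; first by move=> -> /eqP; rewrite eq_sym oner_eq0.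
    by case: (X01 i w).
  by rewrite probability_setC// PX.
under eq_integral => w _.
  rewrite (_ : (expR (s * X i w))%:E = (\1_[set w | X i w = 0%R] w)%:E +
     (expR s)%:E * (\1_[set w | X i w = 1%R] w)%:E)%E; first over.
  rewrite -EFinM -EFinD; congr EFin; rewrite !indicE.
  case: (X01 i w) => XE.
    rewrite mem_set//= memNset/=; first by rewrite XE !mulr0 expR0 addr0.
    by rewrite XE => /eqP; rewrite eq_sym oner_eq0.
  rewrite memNset/= ?mem_set//; first by rewrite XE !mulr1 add0r.
  by rewrite XE => /eqP; rewrite oner_eq0.
have mI (x : R) : measurable_fun setT (fun w => (\1_[set w | X i w = x] w)%:E : \bar R).
  exact/measurable_EFinP/measurable_indic.
have n0 w : setT w -> (0%:E <= (expR s)%:E * (\1_[set w | X i w = 1%R] w)%:E)%E.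
  by move=> _; rewrite mule_ge0// lee_fin expR_ge0.
have mI1 : measurable_fun setT (fun w => (expR s)%:E * (\1_[set w | X i w = 1%R] w)%:E)%E.
  by apply/measurable_EFinP; apply: measurable_funM => //; exact: measurable_indic.
rewrite (ge0_integralD P measurableT _ (mI 0) n0 mI1)//.
rewrite ge0_integralZl_EFin ?expR_ge0//.
have I0 : (\int[P]_w (\1_[set w | X i w = 0%R] w)%:E = (1 - q i)%:E)%E.
  by rewrite integral_indic// setIT; exact: P0.
have I1 : (\int[P]_w (\1_[set w | X i w = 1%R] w)%:E = (q i)%:E)%E.
  by rewrite integral_indic// setIT; exact: PX.
rewrite I0 I1 -EFinM -EFinD; congr EFin; ring.
Qed.

(** Every factor 1 + (e^s - 1) q_i is at most exp((e^s - 1) q_i). Indices outside [b] carry the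
    constant factor 1, so that the product still runs over all of [I]. *)
Lemma integral_expR_sum (s : R) :
  (\int[P]_w (expR (s * \sum_(i | b i) X i w))%:E
    <= (expR ((expR s - 1) * \sum_(i | b i) q i))%:E)%E.
Proof.
pose f i y : R := if b i then expR (s * y) else 1.
pose m i : R := if b i then 1 + (expR s - 1) * q i else 1.
have mf i : measurable_fun setT (f i).
  rewrite /f; case: (b i); last exact: measurable_cst.
  by apply: measurableT_comp => //; exact: measurable_funM.
have f0 i y : 0 <= f i y by rewrite /f; case: (b i); rewrite ?expR_ge0.
have intf i : (\int[P]_w (f i (X i w))%:E = (m i)%:E)%E.
  rewrite /f /m; case: (b i); first exact: integral_expR_bernoulli.
  by rewrite integral_cst// mul1e; exact: probability_setT.
have m0 i : 0 <= m i.
  by rewrite -lee_fin -intf; apply: integral_ge0 => w _; rewrite lee_fin.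
have := @integral_prod_indep _ _ _ P I X setT 1 measurableT (probability_setT P) mX _ f m mf f0 intf.
rewrite mul1r => H.
have -> : (fun w => (expR (s * \sum_(i | b i) X i w))%:E) =
          (fun w => (\1_setT w * \prod_i f i (X i w))%:E).
  apply/funext => w; congr EFin; rewrite indicT mul1r /f -big_mkcond/=.
  by rewrite mulr_sumr expR_sum.
rewrite H; last by move=> B mB; rewrite setTI probability_setT mul1e; exact: indep.
rewrite lee_fin /m mulr_sumr expR_sum [leRHS]big_mkcond/=; apply: ler_prod => i _.
by have := m0 i; rewrite /m; case: (b i) => [->|_]; rewrite ?expR_ge1Dx ?ler01 ?lexx.
Qed.

Let N w := \sum_(i | b i) X i w.

Lemma measurable_success_count : measurable_fun setT N.
Proof.
rewrite (_ : N = fun w => \sum_(i <- [seq i <- index_enum I | b i]) X i w).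
  exact: measurable_sum.
by apply/funext => w; rewrite big_filter.
Qed.

(** Exponential tilt at s = -1: since 1/e <= 1/2, the exponent is at most mu/4 - mu/2. *)
Lemma chernoff_lower (mu : R) : mu <= \sum_(i | b i) q i ->
  (P [set w | (N w <= mu / 4)%R] <= (expR (- (mu / 4)))%:E)%E.
Proof.
move=> hmu; have mN := measurable_success_count.
have -> : [set w | (N w <= mu / 4)%R] = [set w | (- (mu / 4) <= -1 * N w)%R].
  by apply/seteqP; split => w /=; rewrite mulN1r lerN2.
have mZ : measurable_fun setT (fun w => -1 * N w) by exact: measurable_funM.
apply: le_trans (exp_markovT _ mZ) _.
have := integral_expR_sum (-1); move=> /(lee_wpmul2l _)H.
apply: le_trans (H _ _) _; first by rewrite lee_fin expR_ge0.
rewrite -EFinM lee_fin -expRD ler_expR opprK.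
have q0 : 0 <= \sum_(i | b i) q i.
  by apply: sumr_ge0 => i _; rewrite -lee_fin -PX.
have := ler_wpM2r q0 expRN1_le; nra.
Qed.

(** Exponential tilt at s = 1: the exponent is -e mu + (e - 1) mu, which is why the threshold is
    [expR 1 * mu]. *)
Lemma chernoff_upper (mu : R) : \sum_(i | b i) q i <= mu ->
  (P [set w | (expR 1 * mu <= N w)%R] <= (expR (- mu))%:E)%E.
Proof.
move=> hmu; have mN := measurable_success_count.
have -> : [set w | (expR 1 * mu <= N w)%R] = [set w | (expR 1 * mu <= 1 * N w)%R].
  by apply/seteqP; split => w /=; rewrite mul1r.
have mZ : measurable_fun setT (fun w => 1 * N w) by exact: measurable_funM.
apply: le_trans (exp_markovT _ mZ) _.
have := integral_expR_sum 1; move=> /(lee_wpmul2l _)H.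
apply: le_trans (H _ _) _; first by rewrite lee_fin expR_ge0.
rewrite -EFinM lee_fin -expRD ler_expR.
have := expR1_ge2 => e2.
have : (expR 1 - 1) * \sum_(i | b i) q i <= (expR 1 - 1) * mu by rewrite ler_wpM2l//; lra.
lra.
Qed.

End Chernoff.

Section SubGaussian.

Lemma expR_taylor1 (x : R) : expR x <= 1 + x + x ^+ 2 * expR `|x|.
Proof.
have up (y : R) : expR y - 1 <= y * expR y.
  have := expR_ge1Dx (- y) => h.
  have := ler_wpM2r (expR_ge0 y) h; rewrite -expRD addNr expR0; lra.
have x1 := up x.
have [x0|x0] := leP 0 x.
  by rewrite ger0_norm//; have := ler_wpM2l x0 x1; rewrite expr2; lra.
rewrite ltr0_norm//.
have x2 := expR_ge1Dx x.
have x3 : expR x - 1 - x <= x * (expR x - 1) by lra.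
have x4 : 1 <= expR (- x) by rewrite -expR0 ler_expR oppr_ge0 ltW.
have : x * (expR x - 1) <= x ^+ 2.
  rewrite expr2 ler_wnM2l ?(ltW x0)//; lra.
have := ler_wpM2l (sqr_ge0 x) x4; lra.
Qed.

(** With u = s^2 K^2 and v = x^2 / (2 K^2) one has (s x)^2 = 2 u v and |s x| <= u/2 + v, and the
    remaining factor v is at most e^v. The linear term is kept because it integrates to zero. *)
Lemma expR_subgaussian_bound (s x K : R) : 0 < K ->
  expR (s * x) <=
    1 + s * x + 2 * (s ^+ 2 * K ^+ 2) * expR (s ^+ 2 * K ^+ 2 / 2) * expR (x ^+ 2 / K ^+ 2).
Proof.
move=> K0; apply: le_trans (expR_taylor1 _) _; rewrite lerD2l.
pose v := x ^+ 2 / (2 * K ^+ 2).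
have v0 : 0 <= v by rewrite divr_ge0 ?sqr_ge0// mulr_ge0 ?sqr_ge0.
have K2 : K ^+ 2 != 0 by rewrite expf_neq0// gt_eqF.
have xE : x ^+ 2 = 2 * K ^+ 2 * v by rewrite /v; field; rewrite gt_eqF.
have -> : x ^+ 2 / K ^+ 2 = v + v by rewrite xE; field; rewrite gt_eqF.
set u := s ^+ 2 * K ^+ 2.
have am : `|s * x| <= u / 2 + v.
  have h0 := sqr_ge0 (`|s * x| - u).
  have [u0|un0] := eqVneq u 0.
    move: u0; rewrite /u => /eqP; rewrite mulf_eq0 (negbTE K2) orbF sqrf_eq0 => /eqP ->.
    by rewrite mul0r normr0 expr0n/= mul0r mul0r add0r.
  have up : 0 < u by rewrite lt_def un0 mulr_ge0 ?sqr_ge0.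
  rewrite -(ler_pM2l up).
  have n2 : `|s * x| ^+ 2 = 2 * u * v.
    by rewrite real_normK ?num_real// exprMn xE /u; ring.
  have : (`|s * x| - u) ^+ 2 = `|s * x| ^+ 2 - 2 * (u * `|s * x|) + u ^+ 2 by ring.
  move=> h1; rewrite h1 n2 in h0; lra.
have ve : v <= expR v by have := expR_ge1Dx v; lra.
have -> : (s * x) ^+ 2 = 2 * u * v by rewrite exprMn xE /u; ring.
have u0 : 0 <= u by rewrite mulr_ge0 ?sqr_ge0.
rewrite -ler_expR expRD in am.
have -> : 2 * u * expR (u / 2) * expR (v + v) =
  2 * u * (expR v * (expR (u / 2) * expR v)) by rewrite expRD; ring.
have -> : 2 * u * v * expR `|s * x| = 2 * u * (v * expR `|s * x|) by ring.
have u20 : 0 <= 2 * u by apply: mulr_ge0.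
rewrite (ler_wpM2l u20)//; apply: ler_pM => //; exact: expR_ge0.
Qed.

(** Integrating the pointwise bound leaves 1 + 4 u e^(u/2), which is at most e^(u/2) (1 + 9u/2) and
    so at most e^(5u). *)
Lemma subgaussian_mgf (X : T -> R) (K s : R) : 0 < K -> measurable_fun setT X ->
  P.-integrable setT (EFin \o X) -> (\int[P]_w (X w)%:E = 0)%E ->
  (\int[P]_w (expR (X w ^+ 2 / K ^+ 2))%:E <= 2%:E)%E ->
  (\int[P]_w (expR (s * X w))%:E <= (expR (5 * (s ^+ 2 * K ^+ 2)))%:E)%E.
Proof.
move=> K0 mX iX X0 X2; set u := s ^+ 2 * K ^+ 2.
have u0 : 0 <= u by rewrite mulr_ge0 ?sqr_ge0.
pose c := 2 * u * expR (u / 2).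
have c0 : 0 <= c by apply: mulr_ge0; [exact: mulr_ge0|exact: expR_ge0].
pose Q w := expR (X w ^+ 2 / K ^+ 2).
have mQ : measurable_fun setT Q.
  apply: measurableT_comp => //; apply: measurable_funM => //.
  exact: measurable_funX.
have iQ : P.-integrable setT (EFin \o Q).
  apply/integrableP; split; first exact/measurable_EFinP.
  under eq_integral do rewrite /= ger0_norm ?expR_ge0//.
  by apply: le_lt_trans X2 _; rewrite ltry.
have i1 : P.-integrable setT (EFin \o (fun=> 1 : R)) by exact: finite_measure_integrable_cst.
have isX : P.-integrable setT (fun w => s%:E * (X w)%:E)%E by exact: integrableZl.
have icQ : P.-integrable setT (fun w => c%:E * (Q w)%:E)%E by exact: integrableZl.
have i1s := integrableD measurableT i1 isX.
apply: le_trans (_ : (_ <= \int[P]_w (1%:E + s%:E * (X w)%:E + c%:E * (Q w)%:E))%E) _.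
  apply: ge0_le_integral => //.
  - apply/measurable_EFinP; apply: measurableT_comp => //; exact: measurable_funM.
  - by apply: (measurable_int P); exact: integrableD.
  - by move=> w _; rewrite -!EFinM -!EFinD lee_fin; exact: expR_subgaussian_bound.
rewrite (integralD measurableT i1s icQ) (integralD measurableT i1 isX).
have I1 : (\int[P]_w (1%:E : \bar R) = 1%:E)%E.
  by rewrite integral_cst// mul1e; exact: probability_setT.
rewrite !integralZl//= X0 mule0 adde0 I1.
apply: le_trans (_ : (_ <= 1%:E + c%:E * 2%:E)%E) _.
  by rewrite leeD2l// lee_wpmul2l.
rewrite -EFinM -EFinD lee_fin /c.
have -> : 5 * u = u / 2 + 9 / 2 * u by field.
rewrite expRD.
have e1 : 1 <= expR (u / 2) by rewrite -expR0 ler_expR divr_ge0.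
have := expR_ge1Dx (9 / 2 * u) => e2.
have := ler_wpM2l (expR_ge0 (u / 2)) e2.
have := mulr_ge0 u0 (expR_ge0 (u / 2)); lra.
Qed.

(** Keeping [P A] as a factor replaces conditioning on [A], and the bound remains meaningful when
    [A] is null. *)
Lemma subgaussian_sum_tail {I : finType} (X : I -> T -> R) (A : set T) (f : I -> R)
    (K rho t : R) : 0 < K -> 0 < rho -> 0 < t -> measurable A ->
  (forall i, measurable_fun setT (X i)) ->
  (forall i, P.-integrable setT (EFin \o X i)) ->
  (forall i, \int[P]_w (X i w)%:E = 0)%E ->
  (forall i, \int[P]_w (expR (X i w ^+ 2 / K ^+ 2))%:E <= 2%:E)%E ->
  (forall B : I -> set R, (forall i, measurable (B i)) ->
     P (A `&` [set w | forall i, B i (X i w)]) =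
       (P A * \prod_i P (X i @^-1` B i))%E) ->
  \sum_i f i ^+ 2 <= rho ^+ 2 ->
  (P (A `&` [set w | (t <= \sum_i f i * X i w)%R]) <=
     P A * (expR (- (t ^+ 2 / (20 * K ^+ 2 * rho ^+ 2))))%:E)%E.
Proof.
move=> K0 rho0 t0 mA mX iX X0 X2 indep frho.
(* The minimiser of -s t + 5 s^2 K^2 rho^2, with minimum -t^2 / (20 K^2 rho^2). *)
pose s := t / (10 * K ^+ 2 * rho ^+ 2).
have sp : 0 < s by rewrite divr_gt0// !mulr_gt0.
pose Z w := s * \sum_i f i * X i w.
have mZ : measurable_fun setT Z.
  by apply: measurable_funM => //; apply: measurable_sum => i; exact: measurable_funM.
have -> : [set w | (t <= \sum_i f i * X i w)%R] = [set w | (s * t <= Z w)%R].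
  by apply/seteqP; split => w /=; rewrite ler_pM2l.
apply: le_trans (exp_markov _ mA mZ) _.
pose a := fine (P A).
have PA : P A = a%:E by rewrite fineK// fin_num_measure.
pose g i y := expR (s * f i * y).
have mg i : measurable_fun setT (g i).
  by apply: measurableT_comp => //; exact: measurable_funM.
have g0 i y : 0 <= g i y := expR_ge0 _.
have gle i := subgaussian_mgf (s * f i) K0 (mX i) (iX i) (X0 i) (X2 i).
pose m i := fine (\int[P]_w (g i (X i w))%:E)%E.
have intg i : (\int[P]_w (g i (X i w))%:E = (m i)%:E)%E.
  rewrite fineK// ge0_fin_numE; first by apply: le_lt_trans (gle i) _; rewrite ltry.
  by apply: integral_ge0 => w _; rewrite lee_fin.
have m0 i : 0 <= m i.
  by rewrite -lee_fin -intg; apply: integral_ge0 => w _; rewrite lee_fin.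
have mle i : m i <= expR (5 * ((s * f i) ^+ 2 * K ^+ 2)) by rewrite -lee_fin -intg; exact: gle.
have := integral_prod_indep mA PA mX indep mg g0 intg.
have -> : (fun w => (\1_A w * \prod_i g i (X i w))%:E) =
          (fun w => (\1_A w * expR (Z w))%:E).
  apply/funext => w; congr (_ * _)%:E; rewrite /g -expR_sum; congr expR.
  by rewrite /Z mulr_sumr; apply: eq_bigr => i _; rewrite mulrA.
move=> ->; rewrite PA -!EFinM lee_fin mulrCA ler_wpM2l//; first by rewrite -lee_fin -PA.
have : \prod_i m i <= expR (5 * s ^+ 2 * K ^+ 2 * rho ^+ 2).
  apply: le_trans (_ : \prod_i expR (5 * ((s * f i) ^+ 2 * K ^+ 2)) <= _).
    by apply: ler_prod => i _; rewrite m0 mle.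
  rewrite -expR_sum ler_expR.
  rewrite (eq_bigr (fun i => 5 * s ^+ 2 * K ^+ 2 * f i ^+ 2)); last by move=> i _; ring.
  have k0 : 0 <= 5 * s ^+ 2 * K ^+ 2.
    by apply: mulr_ge0 (sqr_ge0 _); apply: mulr_ge0 (sqr_ge0 _); exact: ler0n.
  have -> : \sum_i 5 * s ^+ 2 * K ^+ 2 * f i ^+ 2 = 5 * s ^+ 2 * K ^+ 2 * \sum_i f i ^+ 2.
    by rewrite [RHS]mulr_sumr.
  exact: ler_wpM2l k0 _ _ frho.
move=> /(ler_wpM2l (expR_ge0 (- (s * t)))) /le_trans; apply.
rewrite -expRD ler_expR le_eqVlt; apply/orP; left; apply/eqP.
by rewrite /s; field; rewrite !gt_eqF.
Qed.

End SubGaussian.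
End Tails.

(** * Random graphs: measurability and concentration of cuts *)

Section RandomGraph.
Context {R : realType} {d : measure_display} {T : measurableType d}.
Variable P : probability T R.

Lemma union_bound2 (A B C : set T) (x y : R) :
  measurable A -> measurable B -> measurable C -> A `<=` B `|` C ->
  (P B <= x%:E)%E -> (P C <= y%:E)%E -> (P A <= (x + y)%:E)%E.
Proof.
move=> mA mB mC sub Bx Cy.
have := @union_bound R d T P bool A (fun b => if b then B else C) (fun b => if b then x else y).
rewrite big_bool/=; apply => //.
- by case.
- by move=> w /sub[Bw|Cw]; [exists true|exists false].
- by case.
Qed.

Variables (N : nat) (Phi : T -> 'M[R]_N) (q : 'I_N -> 'I_N -> R).
Hypothesis mPhi : forall i j, measurable_fun setT (fun w => Phi w i j).
Hypothesis Phi01 : forall w i j, Phi w i j = 0 \/ Phi w i j = 1.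

Lemma measurable_Phi_eq (phi : 'M[R]_N) : measurable [set w | Phi w = phi].
Proof.
rewrite (_ : [set w | _] = \bigcap_(e in [set: 'I_N * 'I_N])
   ((fun w => Phi w e.1 e.2) @^-1` [set phi e.1 e.2])).
  apply: fin_bigcap_measurable => // e _; rewrite -[X in measurable X]setTI.
  exact: (mPhi e.1 e.2 measurableT (measurable_set1 _)).
apply/seteqP; split => w /=; first by move=> h e _ /=; rewrite h.
by move=> h; apply/matrixP => i j; exact: (h (i, j)).
Qed.

(** Boolean matrices form a finite type, so unions and sums over the possible values of [Phi] are
    finite. *)
Definition bool_mx (b : 'M[bool]_N) : 'M[R]_N := map_mx (fun x : bool => x%:R) b.

Lemma Phi_bool w : exists b : 'M[bool]_N, Phi w = bool_mx b.
Proof.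
exists (map_mx (fun x => x == 1) (Phi w)); apply/matrixP => i j; rewrite !mxE.
by case: (Phi01 w i j) => ->; rewrite ?eqxx// eq_sym oner_eq0.
Qed.

Lemma measurable_Phi_slices (A : set T) :
  (forall b, measurable ([set w | Phi w = bool_mx b] `&` A)) -> measurable A.
Proof.
move=> mA; rewrite (_ : A = \bigcup_(b in [set: 'M[bool]_N]) ([set w | Phi w = bool_mx b] `&` A)).
  by apply: fin_bigcup_measurable => // b _.
apply/seteqP; split => w /=; last by case=> b _ [].
by move=> Aw; have [b bE] := Phi_bool w; exists b.
Qed.

(** Since [Phi] takes finitely many values, [Q] can be any predicate whatever. *)
Lemma measurable_Phi (Q : 'M[R]_N -> Prop) : measurable [set w | Q (Phi w)].
Proof.
apply: measurable_Phi_slices => b; have [Qb|nQb] := pselect (Q (bool_mx b)).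
  rewrite (_ : _ `&` _ = [set w | Phi w = bool_mx b]); first exact: measurable_Phi_eq.
  by apply/seteqP; split => w /=; [case|move=> e; split=> //; move: Qb; rewrite -e].
rewrite (_ : _ `&` _ = set0); first exact: measurable0.
by apply/seteqP; split => w //= -[e Qw]; apply: nQb; rewrite -e.
Qed.

Lemma union_bound_Phi (Q1 Q2 : 'M[R]_N -> Prop) (x y : R) :
  (P [set w | Q1 (Phi w)] <= x%:E)%E -> (P [set w | Q2 (Phi w)] <= y%:E)%E ->
  (P [set w | Q1 (Phi w) \/ Q2 (Phi w)] <= (x + y)%:E)%E.
Proof.
apply: union_bound2; first exact: (measurable_Phi (fun phi => Q1 phi \/ Q2 phi)).
- exact: measurable_Phi.
- exact: measurable_Phi.
- by move=> w; case=> h; [left|right].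
Qed.

Hypothesis Phisym : forall w i j, Phi w i j = Phi w j i.
Hypothesis Phidiag : forall w i, Phi w i i = 0.
Hypothesis indep : mutually_indep P
  (fun e : {e : 'I_N * 'I_N | (e.1 < e.2)%N} =>
     rv_events (fun w => Phi w (val e).1 (val e).2)).
Hypothesis qsym : forall i j, q i j = q j i.
Hypothesis Pq : forall i j : 'I_N, (i < j)%N -> P [set w | Phi w i j = 1] = (q i j)%:E.

Definition rect (w : 'I_N -> 'I_N -> R) (A B : {set 'I_N}) : R :=
  \sum_(i in A) \sum_(j in B) w i j.

Definition crosses (A B : {set 'I_N}) (e : {e : 'I_N * 'I_N | (e.1 < e.2)%N}) : bool :=
  ((val e).1 \in A) && ((val e).2 \in B) || ((val e).2 \in A) && ((val e).1 \in B).

(** For disjoint [A] and [B] every unordered pair is met at most once, so the weight between them is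
    a sum of distinct entries above the diagonal, which are independent. *)
Lemma rect_crosses (w : 'I_N -> 'I_N -> R) (A B : {set 'I_N}) :
  (forall i j, w i j = w j i) -> A \subset ~: B ->
  rect w A B = \sum_(e | crosses A B e) w (val e).1 (val e).2.
Proof.
move=> wsym dAB; pose g i j := if (i \in A) && (j \in B) then w i j else 0.
have notAB i : ~~ ((i \in A) && (i \in B)).
  by apply/negP => /andP[/(fintype.subsetP dAB)]; rewrite inE => /negbTE ->.
have -> : rect w A B = \sum_i \sum_j g i j.
  rewrite /rect big_mkcond/=; apply: eq_bigr => i _; rewrite /g.
  by case: (i \in A) => /=; [rewrite big_mkcond|rewrite big1].
have E : 2 * \sum_i \sum_j g i j = \sum_i \sum_j (g i j + g j i).
  rewrite mulrDl mul1r; under [RHS]eq_bigr do rewrite big_split/=.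
  by rewrite [RHS]big_split/=; congr (_ + _); rewrite exchange_big.
rewrite (@sum_sym_offdiag R N (fun i j => g i j + g j i)) in E; last 2 first.
- by move=> i j; rewrite addrC.
- by move=> i; rewrite /g (negbTE (notAB i)) addr0.
have -> : \sum_i \sum_j g i j =
    \sum_(e : 'I_N * 'I_N | (e.1 < e.2)%N) (g e.1 e.2 + g e.2 e.1).
  by move/mulfI: E; apply; rewrite pnatr_eq0.
rewrite (big_sub [pred e : 'I_N * 'I_N | (e.1 < e.2)%N]) [RHS]big_mkcond/=.
apply: eq_bigr => -[[i j]/= ij] _; rewrite /crosses /g/=.
case: (boolP ((i \in A) && (j \in B))) => [/andP[iA jB]|_] /=.
  case: ifP => [/andP[jA iB]|_]; last by rewrite addr0.
  by have := notAB i; rewrite iA iB.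
by rewrite add0r; case: ifP => // _; rewrite wsym.
Qed.

Let X (e : {e : 'I_N * 'I_N | (e.1 < e.2)%N}) (w : T) : R := Phi w (val e).1 (val e).2.

Let Xindep (B : {e : 'I_N * 'I_N | (e.1 < e.2)%N} -> set R) :
  (forall e, measurable (B e)) ->
  P [set w | forall e, B e (X e w)] = (\prod_e P (X e @^-1` B e))%E.
Proof. by move=> _; apply: (@indep (fun e => X e @^-1` B e)) => e; exists (B e). Qed.

Lemma rect_lower (A B : {set 'I_N}) (mu : R) : A \subset ~: B -> mu <= rect q A B ->
  (P [set w | (rect (Phi w) A B <= mu / 4)%R] <= (expR (- (mu / 4)))%:E)%E.
Proof.
move=> dAB; rewrite rect_crosses// => hmu.
have -> : [set w | (rect (Phi w) A B <= mu / 4)%R] =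
          [set w | (\sum_(e | crosses A B e) X e w <= mu / 4)%R].
  by apply/seteqP; split => w /=; rewrite rect_crosses.
apply: (chernoff_lower (q := fun e => q (val e).1 (val e).2)) => //.
- by move=> e; exact: mPhi.
- by move=> e w; exact: Phi01.
- by move=> e; exact: (Pq (valP e)).
Qed.

Lemma rect_upper (A B : {set 'I_N}) (mu : R) : A \subset ~: B -> rect q A B <= mu ->
  (P [set w | (expR 1 * mu <= rect (Phi w) A B)%R] <= (expR (- mu))%:E)%E.
Proof.
move=> dAB; rewrite rect_crosses// => hmu.
have -> : [set w | (expR 1 * mu <= rect (Phi w) A B)%R] =
          [set w | (expR 1 * mu <= \sum_(e | crosses A B e) X e w)%R].
  by apply/seteqP; split => w /=; rewrite rect_crosses.
apply: (chernoff_upper (q := fun e => q (val e).1 (val e).2)) => //.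
- by move=> e; exact: mPhi.
- by move=> e w; exact: Phi01.
- by move=> e; exact: (Pq (valP e)).
Qed.

(** * The random graph is good with high probability *)

Section GoodGraphProbability.
Import mathcomp.boot.fintype mathcomp.boot.finset.
Variables (V : {set 'I_N}) (m : nat) (pw pb : R).
Hypotheses (m0 : (0 < m)%N) (NE : N = m.*2) (cV : #|V| = m).
Hypotheses (pw0 : 0 <= pw) (pb0 : 0 <= pb).
Hypothesis qE : forall i j, q i j = if (i \in V) == (j \in V) then pw else pb.
Hypothesis hpw : 16 * ln N%:R <= m%:R * pw.
Hypothesis hpb : 16 * ln N%:R <= m%:R * pb.

Let N0 : (0 < N)%N. Proof. by rewrite NE double_gt0. Qed.
Let N0R : 0 < N%:R :> R. Proof. by rewrite ltr0n. Qed.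
Let mR0 : 0 < m%:R :> R. Proof. by rewrite ltr0n. Qed.

Let cVc : #|~: V| = m.
Proof.
apply/eqP; rewrite -(eqn_add2l m) addnn; apply/eqP.
by rewrite -[in LHS]cV cardsC card_ord.
Qed.

Lemma sum_setpow (x : R) :
  \sum_(S : {set 'I_N}) x ^+ #|S| = (1 + x) ^+ N.
Proof.
have := @bigA_distr R 0 1 *%R +%R 'I_N (fun=> x) (fun=> 1).
rewrite prodr_const card_ord addrC => ->; apply: eq_big => [S|S _]; first by rewrite inE.
by rewrite -big_mkcond/= prodr_const.
Qed.

(** By the binomial theorem the sum is (1 + x)^N - 1 with x = e^(-c) <= N^(-2). With u = N x <= 1/2
    this is at most e^u - 1 <= 2 u <= 2 / N. *)
Lemma sum_nonempty_expR (c : R) : 2 * ln N%:R <= c ->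
  \sum_(S : {set 'I_N}) (if S == set0 then 0 else expR (- (c * #|S|%:R))) <= 2 / N%:R.
Proof.
move=> hc; set x := expR (- c).
have x0 : 0 <= x by exact: expR_ge0.
have -> : \sum_(S : {set 'I_N}) (if S == set0 then 0 else expR (- (c * #|S|%:R))) =
   (1 + x) ^+ N - 1.
  rewrite -sum_setpow (bigD1 set0)//= eqxx add0r [in RHS](bigD1 set0)//= cards0 expr0.
  rewrite [RHS]addrC addKr; apply: eq_bigr => S /negbTE ->.
  by rewrite /x -expRM_natr; congr expR; ring.
set u := N%:R * x.
have u1 : u <= 1 / N%:R.
  rewrite ler_pdivlMr// /u.
  have -> : N%:R * x * N%:R = N%:R ^+ 2 * x by ring.
  have NL : N%:R ^+ 2 = expR (2 * ln N%:R) :> R.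
    by rewrite mulrC expRM_natr lnK ?posrE.
  by rewrite NL /x -expRD -[leRHS]expR0 ler_expR; lra.
have u0 : 0 <= u by rewrite mulr_ge0// ltW.
have N2 : 2 <= N%:R :> R by rewrite NE -mul2n natrM ler_peMr// ler1n.
have u2 : u <= 1 / 2.
  by apply: le_trans u1 _; rewrite !div1r lef_pV2 ?posrE.
have e1 : (1 + x) ^+ N <= expR u.
  rewrite /u mulrC expRM_natr lerXn2r ?nnegrE ?expR_ge0 ?addr_ge0// expR_ge1Dx//.
have e2 : expR u * (1 - u) <= 1.
  have := ler_wpM2l (expR_ge0 u) (expR_ge1Dx (- u)).
  by rewrite -expRD subrr expR0.
have e3 : expR u <= 2.
  have := expR_ge0 u; nra.
have : expR u - 1 <= 2 * u by nra.
have : 2 / N%:R = 2 * (1 / N%:R) :> R by rewrite mul1r.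
lra.
Qed.

(** Union bound over subsets: a set of size s fails with probability at most exp(- (m p / 8) s), and
    16 ln N <= m p makes the rate m p / 8 at least 2 ln N. The empty set never fails and must be
    excluded, as its Chernoff bound would be 1. The predicate [ok] serves all three balance
    conditions. *)
Lemma cut_family_prob (B : {set 'I_N}) (p : R) (ok : pred {set 'I_N}) :
  16 * ln N%:R <= m%:R * p ->
  (forall S : {set 'I_N}, S \subset B -> ok S -> m%:R * p / 2 * #|S|%:R <= rect q S (B :\: S)) ->
  (P (mkset (fun w => ~ (forall S : {set 'I_N}, S \subset B -> ok S ->
        (m%:R * p / 8 * #|S|%:R <= cut_weight (Phi w) S B)%R))) <= (2 / N%:R)%:E)%E.
Proof.
move=> hp hq.
pose bad (S : {set 'I_N}) := mkset (fun w => [/\ S \subset B, ok S, S != set0 &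
  (cut_weight (Phi w) S B < m%:R * p / 8 * #|S|%:R)%R]).
pose x (S : {set 'I_N}) := if S == set0 then 0 else expR (- (m%:R * p / 8 * #|S|%:R)).
apply: le_trans (@union_bound R d T P _ _ bad x _ _ _ _) _.
- exact: (measurable_Phi (fun phi => ~ (forall S : {set 'I_N}, S \subset B -> ok S ->
        (m%:R * p / 8 * #|S|%:R <= cut_weight phi S B)%R))).
- move=> S; exact: (measurable_Phi (fun phi => [/\ S \subset B, ok S, S != set0 &
  (cut_weight phi S B < m%:R * p / 8 * #|S|%:R)%R])).
- move=> w /existsNP[S] /not_implyP[SB] /not_implyP[okS] /negP; rewrite -ltNge => lt.
  exists S; split=> //; apply: contraTneq lt => ->.
  by rewrite cards0 mulr0 /cut_weight big_set0 ltxx.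
- move=> S; rewrite /x; have [S0|S0] := eqVneq S set0.
    rewrite (_ : bad S = classical_sets.set0) ?measure0//.
    by apply/seteqP; split => w //= -[_ _ /negP]; rewrite S0.
  have [/andP[SB okS]|nS] := boolP ((S \subset B) && ok S); last first.
    rewrite (_ : bad S = classical_sets.set0) ?measure0 ?lee_fin ?expR_ge0//.
    by apply/seteqP; split => w //= -[SB okS]; rewrite SB okS in nS.
  have dS : S \subset ~: (B :\: S).
    by apply/subsetP => i iS; rewrite !inE iS.
  have := rect_lower dS (hq S SB okS).
  have -> : m%:R * p / 2 * #|S|%:R / 4 = m%:R * p / 8 * #|S|%:R by field.
  apply: le_trans; apply: le_measure.
  + apply/mem_set; exact: (measurable_Phi (fun phi => [/\ S \subset B, ok S, S != set0 &
      (cut_weight phi S B < m%:R * p / 8 * #|S|%:R)%R])).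
  + apply/mem_set; exact: (measurable_Phi (fun phi => (rect phi S (B :\: S) <= m%:R * p / 8 * #|S|%:R)%R)).
  + by move=> w [_ _ _ /ltW].
by rewrite lee_fin; apply: sum_nonempty_expR; lra.
Qed.

Lemma rect_const (A B : {set 'I_N}) (c : R) :
  (forall i j, i \in A -> j \in B -> q i j = c) -> rect q A B = #|A|%:R * #|B|%:R * c.
Proof.
move=> qc; rewrite /rect (eq_bigr (fun=> #|B|%:R * c)).
  by rewrite sumr_const -[LHS]mulr_natl mulrA.
move=> i iA; rewrite (eq_bigr (fun=> c)) ?sumr_const ?mulr_natl// => j jB.
exact: qc.
Qed.

Lemma rect_block_cut (B S : {set 'I_N}) : #|B| = m ->
  (forall i j, i \in B -> j \in B -> q i j = pw) -> S \subset B -> (2 * #|S| <= #|B|)%N ->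
  m%:R * pw / 2 * #|S|%:R <= rect q S (B :\: S).
Proof.
move=> cB qB SB; rewrite cB => cS.
rewrite (rect_const (c := pw)); last first.
  by move=> i j iS; rewrite inE => /andP[_ jB]; apply: qB => //; exact: (subsetP SB).
have -> : #|B :\: S| = (m - #|S|)%N by rewrite cardsD (setIidPr SB) cB.
have lS : (#|S| <= m)%N by rewrite -cB subset_leq_card.
rewrite natrB//.
have : 2 * #|S|%:R <= m%:R :> R by rewrite -natrM ler_nat.
move=> h; have := mulr_ge0 (mulr_ge0 (ler0n R #|S|) pw0) (_ : 0 <= m%:R - 2 * #|S|%:R).
by rewrite subr_ge0 => /(_ h); lra.
Qed.

(** Only cross-block pairs are counted, so the bound holds with [pb] whatever the size of [pw]. If
    [S] has a and b points in the two blocks, then a (m - b) + b (m - a) >= m (a + b) / 2 because a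
    + b <= m. *)
Lemma rect_whole_cut (S : {set 'I_N}) : (2 * #|S| <= N)%N ->
  m%:R * pb / 2 * #|S|%:R <= rect q S (setT :\: S).
Proof.
move=> cS.
have q0 i j : 0 <= q i j by rewrite qE; case: ifP.
have split : rect q (S :&: V) (~: V :\: S) + rect q (S :\: V) (V :\: S) <= rect q S (setT :\: S).
  rewrite /rect [leRHS](big_setID V)/=; apply: lerD.
    apply: ler_sum => i _; rewrite [leRHS](big_setID (~: V))/=.
    have -> : (setT :\: S) :&: ~: V = ~: V :\: S by apply/setP => j; rewrite !inE andbT.
    by rewrite lerDl sumr_ge0.
  apply: ler_sum => i _; rewrite [leRHS](big_setID V)/=.
  have -> : (setT :\: S) :&: V = V :\: S by apply/setP => j; rewrite !inE andbT.
  by rewrite lerDl sumr_ge0.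
apply: le_trans split.
rewrite (rect_const (c := pb)); last first.
  by move=> i j; rewrite !inE qE => /andP[_ ->] /andP[_ /negbTE ->].
rewrite (rect_const (c := pb)); last first.
  by move=> i j; rewrite !inE qE => /andP[/negbTE -> _] /andP[_ ->].
set a := #|S :&: V|; set b := #|S :\: V|.
have Sab : #|S| = (a + b)%N by rewrite /a /b cardsID.
have c1 : #|V :\: S| = (m - a)%N by rewrite cardsD cV setIC.
have am : (a <= m)%N by rewrite -cV subset_leq_card// subsetIr.
have bE : S :\: V = ~: V :&: S by apply/setP => j; rewrite !inE.
have c2 : #|~: V :\: S| = (m - b)%N by rewrite cardsD cVc /b bE.
have bm : (b <= m)%N by rewrite /b bE -cVc subset_leq_card// subsetIl.
rewrite c1 c2 !natrB// Sab natrD.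
have h : a%:R + b%:R <= m%:R :> R.
  rewrite -natrD ler_nat -Sab -leq_double -mul2n; apply: leq_trans cS _.
  by rewrite NE.
set x : R := a%:R; set y : R := b%:R.
have x0 : 0 <= x by exact: ler0n.
have y0 : 0 <= y by exact: ler0n.
have k1 : m%:R / 2 * (x + y) <= x * (m%:R - y) + y * (m%:R - x).
  have := ler_wpM2l (addr_ge0 x0 y0) h; rewrite -/x -/y.
  have := sqr_ge0 (x - y); nra.
have := ler_wpM2r pb0 k1; lra.
Qed.

(** [B i] may contain [i], as the own block does; the zero diagonal lets [i] be removed, after which
    the singleton and the rest are disjoint and the upper Chernoff bound applies. Each vertex fails
    with probability at most N^(-2). *)
Lemma degree_prob (B : 'I_N -> {set 'I_N}) (p : R) :
  (forall i, #|B i| = m) -> (forall i j, j \in B i -> q i j = p) -> 0 <= p ->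
  16 * ln N%:R <= m%:R * p ->
  (P (mkset (fun w => ~ forall i, (\sum_(j in B i) Phi w i j <= expR 1 * (m%:R * p))%R))
     <= (1 / N%:R)%:E)%E.
Proof.
move=> cB qB p0 hp.
have sE w i : \sum_(j in B i) Phi w i j = rect (Phi w) [set i] (B i :\ i).
  rewrite /rect big_set1; case: (boolP (i \in B i)) => iB.
    by rewrite (big_setD1 i)//= Phidiag add0r.
  by apply: eq_bigl => j; rewrite !inE andb_idl// => jB; apply: contraNneq iB => ji; rewrite -{1}ji.
apply: le_trans (@union_bound R d T P _ _
  (fun i => mkset (fun w => (expR 1 * (m%:R * p) <= rect (Phi w) [set i] (B i :\ i))%R))
  (fun=> expR (- (m%:R * p))) _ _ _ _) _.
- exact: (measurable_Phi (fun phi => ~ forall i, (\sum_(j in B i) phi i j <= expR 1 * (m%:R * p))%R)).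
- by move=> i; exact: (measurable_Phi (fun phi => (expR 1 * (m%:R * p) <= rect phi [set i] (B i :\ i))%R)).
- by move=> w /existsNP[i] /negP; rewrite -ltNge sE => /ltW; exists i.
- move=> i; apply: rect_upper.
    by apply/subsetP => j; rewrite !inE => ->.
  rewrite (rect_const (c := p)).
    rewrite cards1 mul1r ler_wpM2r// ler_nat -(cB i) subset_leq_card// subD1set//.
  by move=> k j; rewrite !inE => /eqP -> /andP[_]; exact: qB.
rewrite lee_fin sumr_const card_ord -[leLHS]mulr_natl ler_pdivlMr//.
have -> : N%:R * expR (- (m%:R * p)) * N%:R = N%:R ^+ 2 * expR (- (m%:R * p)) by ring.
have NL : N%:R ^+ 2 = expR (2 * ln N%:R) :> R by rewrite mulrC expRM_natr lnK ?posrE.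
have lnN : 0 <= ln N%:R :> R by rewrite ln_ge0// ler1n.
by rewrite NL -expRD -[leRHS]expR0 ler_expR; lra.
Qed.

Lemma good_graph_prob :
  (P (mkset (fun w => ~ good_graph (Phi w) V (expR 1) pw pb)) <= (9 / N%:R)%:E)%E.
Proof.
have lnN : 0 <= ln N%:R :> R by rewrite ln_ge0// ler1n.
have qw i j : (i \in V) = (j \in V) -> q i j = pw by move=> e; rewrite qE e eqxx.
have qVc i j : i \in ~: V -> j \in ~: V -> q i j = pw.
  by rewrite !inE => /negbTE iV /negbTE jV; apply: qw; rewrite iV jV.
have b1 := @cut_family_prob V pw (fun S => 2 * #|S| <= #|V|)%N hpw
  (fun S => @rect_block_cut V S cV (fun i j iV jV => qw i j (etrans iV (esym jV)))).
have b2 := @cut_family_prob (~: V) pw (fun S => 2 * #|S| <= #|~: V|)%N hpw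
  (fun S => @rect_block_cut (~: V) S cVc qVc).
have b3 := @cut_family_prob setT pb (fun S => 2 * #|S| <= N)%N hpb
  (fun S _ => @rect_whole_cut S).
pose Bw i := [set j | (i \in V) == (j \in V)]; pose Bb i := [set j | (i \in V) != (j \in V)].
have cBw i : #|Bw i| = m.
  have [iV|iV] := boolP (i \in V).
    by rewrite -[RHS]cV; apply: eq_card => j; rewrite inE iV; case: (j \in V).
  by rewrite -[RHS]cVc; apply: eq_card => j; rewrite !inE (negbTE iV); case: (j \in V).
have cBb i : #|Bb i| = m.
  have [iV|iV] := boolP (i \in V).
    by rewrite -[RHS]cVc; apply: eq_card => j; rewrite !inE iV; case: (j \in V).
  by rewrite -[RHS]cV; apply: eq_card => j; rewrite !inE (negbTE iV); case: (j \in V).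
have qBw i j : j \in Bw i -> q i j = pw by rewrite inE qE => ->.
have qBb i j : j \in Bb i -> q i j = pb by rewrite inE qE => /negbTE ->.
have b4 := degree_prob cBw qBw pw0 hpw.
have b5 := degree_prob cBb qBb pb0 hpb.
have dV : V \subset ~: (~: V) by rewrite setCK.
(* Here the expected weight is m^2 pb, and a quarter of it exceeds ln N because m pb does so with
   room to spare. *)
have b6 : (P (mkset (fun w => (rect (Phi w) V (~: V) <= m%:R ^+ 2 * pb / 4)%R)) <= (1 / N%:R)%:E)%E.
  apply: le_trans (rect_lower dV _) _.
    rewrite (rect_const (c := pb)) ?cV ?cVc ?expr2//.
    by move=> i j iV; rewrite inE qE iV => /negbTE ->.
  rewrite lee_fin.
  have -> : 1 / N%:R = expR (- ln N%:R) :> R by rewrite expRN lnK ?posrE// div1r.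
  rewrite ler_expR lerN2.
  have m1 : 1 <= m%:R :> R by rewrite ler1n.
  have := ler_wpM2r (mulr_ge0 (ltW mR0) pb0) m1.
  have -> : m%:R ^+ 2 * pb / 4 = m%:R * (m%:R * pb) / 4 by ring.
  by move: hpb lnN; set L := ln _; set a := m%:R * pb; set b := m%:R * a; lra.
pose E1 phi := forall S : {set 'I_N}, S \subset V -> (2 * #|S| <= #|V|)%N ->
        (m%:R * pw / 8 * #|S|%:R <= cut_weight (fun_of_matrix phi) S V)%R.
pose E2 phi := forall S : {set 'I_N}, S \subset ~: V -> (2 * #|S| <= #|~: V|)%N ->
        (m%:R * pw / 8 * #|S|%:R <= cut_weight (fun_of_matrix phi) S (~: V))%R.
pose E3 phi := forall S : {set 'I_N}, S \subset setT -> (2 * #|S| <= N)%N ->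
        (m%:R * pb / 8 * #|S|%:R <= cut_weight (fun_of_matrix phi) S setT)%R.
pose E4 (phi : 'M[R]_N) := forall i, (\sum_(j in Bw i) phi i j <= expR 1 * (m%:R * pw))%R.
pose E5 (phi : 'M[R]_N) := forall i, (\sum_(j in Bb i) phi i j <= expR 1 * (m%:R * pb))%R.
pose E6 phi := (rect (fun_of_matrix phi) V (~: V) <= m%:R ^+ 2 * pb / 4)%R.
have u56 := @union_bound_Phi (fun phi => ~ E5 phi) E6 _ _ b5 b6.
have u46 := @union_bound_Phi (fun phi => ~ E4 phi) (fun phi => ~ E5 phi \/ E6 phi) _ _ b4 u56.
have u36 := @union_bound_Phi (fun phi => ~ E3 phi)
  (fun phi => ~ E4 phi \/ (~ E5 phi \/ E6 phi)) _ _ b3 u46.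
have u26 := @union_bound_Phi (fun phi => ~ E2 phi)
  (fun phi => ~ E3 phi \/ (~ E4 phi \/ (~ E5 phi \/ E6 phi))) _ _ b2 u36.
have u16 := @union_bound_Phi (fun phi => ~ E1 phi)
  (fun phi => ~ E2 phi \/ (~ E3 phi \/ (~ E4 phi \/ (~ E5 phi \/ E6 phi)))) _ _ b1 u26.
move: u16.
(* Three families of cuts cost 2/N each; the two degree bounds and the total weight between the
   blocks cost 1/N each. *)
have -> : 2 / N%:R + (2 / N%:R + (2 / N%:R + (1 / N%:R + (1 / N%:R + 1 / N%:R)))) = 9 / N%:R :> R.
  by field; rewrite gt_eqF.
apply: le_trans; apply: le_measure.
- apply/mem_set; exact: (measurable_Phi (fun phi => ~ good_graph phi V (expR 1) pw pb)).
- apply/mem_set; exact: (measurable_Phi (fun phi => ~ E1 phi \/ (~ E2 phi \/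
    (~ E3 phi \/ (~ E4 phi \/ (~ E5 phi \/ E6 phi)))))).
move=> w /=; apply: contra_notP => /not_orP[/contrapT g1 /not_orP[/contrapT g2
  /not_orP[/contrapT g3 /not_orP[/contrapT g4 /not_orP[/contrapT g5 g6]]]]].
split; rewrite ?cV.
- by split=> S SV hS; [apply: g1 => //; rewrite cV|apply: g2].
- by move=> S; rewrite card_ord; apply: g3; exact: subsetT.
- move=> i; apply: le_trans (g4 i); rewrite le_eqVlt; apply/orP; left.
  by apply/eqP/eq_bigl => j; rewrite inE.
- move=> i; apply: le_trans (g5 i); rewrite le_eqVlt; apply/orP; left.
  by apply/eqP/eq_bigl => j; rewrite inE.
- by move: g6 => /negP; rewrite -ltNge => /ltW.
Qed.

End GoodGraphProbability.
End RandomGraph.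

(** * The maximum norm *)

Section MaxNorm.
Context {R : realType}.

Lemma ler_maxnorm (m q : nat) (M : 'M[R]_(m, q)) (t : R) :
  0 <= t -> (forall i j, `|M i j| <= t) -> maxnorm M <= t.
Proof.
by move=> t0 Mt; apply: bigmax_le => // i _; apply: bigmax_le => // j _.
Qed.

Lemma maxnorm_ge0 (m q : nat) (M : 'M[R]_(m, q)) : 0 <= maxnorm M.
Proof. exact: bigmax_ge_id. Qed.

Lemma measurable_maxnorm d (T : measurableType d) (m q : nat) (M : T -> 'M[R]_(m, q)) :
  (forall i j, measurable_fun setT (fun w => M w i j)) ->
  measurable_fun setT (fun w => maxnorm (M w)).
Proof.
move=> mM.
have mbig (I : Type) (s : seq I) (F : I -> T -> R) :
    (forall i, measurable_fun setT (F i)) ->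
    measurable_fun setT (fun w => \big[Num.max/0]_(i <- s) F i w).
  move=> mF; elim: s => [|i s IH].
    by under eq_fun do rewrite big_nil; exact: measurable_cst.
  by under eq_fun do rewrite big_cons; exact: measurable_maxr.
apply: (mbig) => i; apply: (mbig) => j; exact: measurableT_comp.
Qed.

Lemma measurable_gt_set d (T : measurableType d) (f : T -> R) (c : R) :
  measurable_fun setT f -> measurable [set w | c < f w].
Proof.
move=> mf; rewrite (_ : [set w | c < f w] = ~` [set w | f w <= c]).
  apply: measurableC; rewrite -[X in measurable X]setTI.
  exact: measurable_fun_le.
by apply/seteqP; split => w /=; rewrite ltNge => /negP.
Qed.

End MaxNorm.

(** * Tail bound at a fixed sample size *)

Section FixedSize.
Context {R : realType} {d : measure_display} {T : measurableType d}.
Variable P : probability T R.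

(** The coordinate vector at [k] is an admissible direction. The infimum in the norm need not be
    attained, and [sigma + 1] lies strictly above it, hence above some admissible positive [K]; the
    bound is monotone in [K]. *)
Lemma subg_norm_entry (p : nat) (Y : T -> 'rV[R]_p) (sigma : R) (k : 'I_p) :
  (forall k, measurable_fun setT (fun w => Y w 0 k)) -> subg_norm P Y = sigma%:E ->
  0 < sigma + 1 /\
  (\int[P]_w (expR (Y w 0 k ^+ 2 / (sigma + 1) ^+ 2))%:E <= 2%:E)%E.
Proof.
move=> mY sgY; pose v : 'rV[R]_p := delta_mx 0 k.
have v1 : l2norm v = 1.
  rewrite /l2norm (bigD1 k)//= big1 ?addr0; first by rewrite mxE !eqxx expr1n sqrtr1.
  by move=> j /negbTE jk; rewrite mxE jk andbF expr0n.
have vY w : (v *m (Y w)^T) 0 0 = Y w 0 k.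
  rewrite mxE (bigD1 k)//= big1 ?addr0; first by rewrite !mxE !eqxx mul1r.
  by move=> j /negbTE jk; rewrite !mxE jk andbF mul0r.
pose S := [set K : R | 0 < K /\
   (\int[P]_w (expR (((v *m (Y w)^T) 0 0) ^+ 2 / K ^+ 2))%:E <= 2%:E)%E].
have lt : (ereal_inf [set K%:E | K in S] < (sigma + 1)%:E)%E.
  apply: (@le_lt_trans _ _ sigma%:E); last by rewrite lte_fin ltrDl.
  by rewrite -sgY; apply: ereal_sup_ubound; exists v.
have [_ [K [K0 KS] <-]] := ereal_inf_lt lt; rewrite lte_fin => Klt.
have s0 := lt_trans K0 Klt; split=> //.
apply: le_trans KS; apply: ge0_le_integral => //.
- apply/measurable_EFinP; apply: measurableT_comp => //; apply: measurable_funM => //.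
  exact: measurable_funX.
- apply/measurable_EFinP; apply: measurableT_comp => //; apply: measurable_funM => //.
  by under eq_fun do rewrite vY; exact: measurable_funX.
- move=> w _; rewrite lee_fin ler_expR vY ler_wpM2l ?sqr_ge0//.
  by rewrite lef_pV2 ?posrE ?exprn_gt0// ler_pXn2r ?nnegrE ?ltW.
Qed.

Variables (m p : nat) (c1 c2 : 'rV[R]_p) (sigma pw pb : R).
Local Notation N := (m.*2).
Variables (E : T -> 'M[R]_(N, p)) (Phi : T -> 'M[R]_N).
Variable Fdag : forall w : T, 'M[R]_(#|edges (Phi w)|, N).
Hypothesis hEmeas : forall i k, measurable_fun setT (fun w => E w i k).
Hypothesis hEint : forall i k, P.-integrable setT (fun w => (E w i k)%:E).
Hypothesis hEmean : forall i k, (\int[P]_w (E w i k)%:E = 0)%E.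
Hypothesis hEsubg : forall i, subg_norm P (fun w => row i (E w)) = sigma%:E.
Hypothesis hErows : mutually_indep P (row_events E).
Hypothesis hPhimeas : forall i j, measurable_fun setT (fun w => Phi w i j).
Hypothesis hPhi01 : forall w i j, Phi w i j = 0 \/ Phi w i j = 1.
Hypothesis hPhisym : forall w i j, Phi w i j = Phi w j i.
Hypothesis hPhidiag : forall w i, Phi w i i = 0.
Hypothesis hPhiE : indep2 P (fmx_events Phi) (mx_events E).
Hypothesis hFdag : forall w, is_MP_pinv (incidence (Phi w)) (Fdag w).

(** A column takes one entry from each row, so independence of the rows suffices, whatever the
    dependence within a row; the other coordinates are left unconstrained by taking the full set
    there. *)
Lemma slice_column_indep (phi : 'M[R]_N) (k : 'I_p) (B : 'I_N -> set R) :
  (forall i, measurable (B i)) ->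
  P ([set w | Phi w = phi] `&` [set w | forall i, B i (E w i k)]) =
  (P [set w | Phi w = phi] * \prod_i P ((fun w => E w i k) @^-1` B i))%E.
Proof.
move=> mB; pose B' i (l : 'I_p) := if l == k then B i else setT.
have mB' i l : measurable (B' i l) by rewrite /B'; case: ifP.
have eB (A : 'I_p -> R) i : (forall l, B' i l (A l)) <-> B i (A k).
  split=> [/(_ k)|BA l]; rewrite /B' ?eqxx//.
  by case: eqP => // ->.
rewrite hPhiE; [|by exists [set phi]|].
- congr (_ * _)%E.
  have := @hErows (fun i => (fun w => E w i k) @^-1` B i); apply => i.
  exists (B' i); split=> //; apply/seteqP; split => w /=.
    by move=> h; apply/(eB (fun l => E w i l)).
  by move/(eB (fun l => E w i l)).
exists B'; split=> //; apply/seteqP; split => w /= h i.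
  by apply/(eB (fun l => E w i l)).
by apply/(eB (fun l => E w i l)); exact: h.
Qed.

(** The left-hand side of the theorem with graph, pseudoinverse and noise as separate arguments, so
    that the first two can be frozen while the noise varies. *)
Definition stat (phi : 'M[R]_N) (F : 'M[R]_(#|edges phi|, N)) (X : 'M[R]_(N, p)) : R :=
  maxnorm (F *m X) / N%:R *
    \sum_(e in edges phi) Num.sqrt (phi e.1 e.2) *
      l2norm (row e.1 (Umat m c1 c2) - row e.2 (Umat m c1 c2)).

(** The type of [F] depends on the graph, so two pseudoinverses can be compared only after their
    graphs have been identified. *)
Lemma stat_congr (phi phi' : 'M[R]_N) F F' (X : 'M[R]_(N, p)) :
  phi = phi' -> is_MP_pinv (incidence phi) F -> is_MP_pinv (incidence phi') F' ->
  stat F X = stat F' X.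
Proof. by move=> e; case: _ / e F' => F' hF hF'; rewrite (MP_pinv_uniq hF hF'). Qed.

Let LHS w := stat (Fdag w) (E w).

Lemma slice_event (c : R) (w0 : T) :
  [set w | Phi w = Phi w0] `&` [set w | c < LHS w] =
  [set w | Phi w = Phi w0] `&` [set w | c < stat (Fdag w0) (E w)].
Proof.
by apply/seteqP; split => w /= -[e];
  rewrite /LHS (stat_congr _ e (hFdag w) (hFdag w0)); split.
Qed.

Lemma measurable_stat (phi : 'M[R]_N) (F : 'M[R]_(#|edges phi|, N)) :
  measurable_fun setT (fun w => maxnorm (F *m E w)).
Proof.
apply: measurable_maxnorm => i j; under eq_fun do rewrite mxE.
by apply: measurable_sum => k; exact: measurable_funM.
Qed.

(** On an event fixing the graph the pseudoinverse is a constant matrix, so the statistic is there a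
    measurable function of the noise. *)
Lemma measurable_LHS_gt (c : R) : measurable [set w | c < LHS w].
Proof.
apply: (measurable_Phi_slices hPhi01) => b.
have [[w0 bE]|nb] := pselect (exists w, Phi w = bool_mx b).
  rewrite -bE slice_event; apply: measurableI; first exact: measurable_Phi_eq.
  by apply: measurable_gt_set; apply: measurable_funM => //; apply: measurable_funM => //;
    exact: measurable_stat.
rewrite (_ : _ `&` _ = set0); first exact: measurable0.
by apply/seteqP; split => w //= -[e _]; apply: nb; exists w.
Qed.

Let V : {set 'I_N} := [set i : 'I_N | (i < m)%N]%SET.

(** Edges inside a block contribute zero and at most m D edges cross, each contributing the distance
    of the centres; the denominator 2 m leaves D / 2. *)
Lemma stat_le (phi : 'M[R]_N) (F : 'M[R]_(#|edges phi|, N)) (X : 'M[R]_(N, p)) (D : R) :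
  (0 < m)%N -> (forall i j, phi i j = 0 \/ phi i j = 1) ->
  (#|V| = m)%N -> 0 <= D ->
  (forall i, \sum_(j | (i \in V) != (j \in V)) phi i j <= D) ->
  stat F X <= maxnorm (F *m X) * (D * l2norm (c1 - c2) / 2).
Proof.
move=> m0 phi01 cV D0 degb; set dl := l2norm _.
have dl0 : 0 <= dl by exact: sqrtr_ge0.
have phi0 i j : 0 <= phi i j by case: (phi01 i j) => ->.
have rowE (i : 'I_N) : row i (Umat m c1 c2) = if i \in V then c1 else c2.
  by apply/rowP => k; rewrite !mxE inE; case: ifP.
have hsum : \sum_(e in edges phi) Num.sqrt (phi e.1 e.2) *
      l2norm (row e.1 (Umat m c1 c2) - row e.2 (Umat m c1 c2)) <= m%:R * D * dl.
  apply: le_trans (_ : \sum_(i in V) \sum_(j | (i \in V) != (j \in V)) phi i j * dl <= _).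
    rewrite [X in X <= _](eq_bigr (fun e => 1 *
      l2norm (row e.1 (Umat m c1 c2) - row e.2 (Umat m c1 c2)))); last first.
      by move=> e; rewrite inE => /andP[_ /eqP ->]; rewrite sqrtr1.
    rewrite pair_big_dep/= big_mkcond [leRHS]big_mkcond/=; apply: ler_sum => -[i j] _ /=.
    rewrite !rowE inE/=; case: ifP => [/andP[ij /eqP ->]|_]; last first.
      by case: ifP => // _; rewrite mulr_ge0.
    (* Edges are ordered by i < j and [V] consists of the smaller indices, so a crossing edge has
       its first endpoint in [V]. *)
    rewrite !mul1r; case: (boolP (i \in V)) => iV; case: (boolP (j \in V)) => jV /=.
    - by rewrite subrr /l2norm big1 ?sqrtr0// => k _; rewrite mxE expr0n.
    - by [].
    - move: iV jV ij; rewrite !inE -leqNgt => mi jm ij.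
      by have := leq_trans (ltn_trans ij jm) mi; rewrite ltnn.
    - by rewrite subrr /l2norm big1 ?sqrtr0// => k _; rewrite mxE expr0n.
  apply: le_trans (_ : \sum_(i in V) D * dl <= _).
    by apply: ler_sum => i _; rewrite -mulr_suml ler_wpM2r.
  by rewrite sumr_const cV -[leLHS]mulr_natl mulrA.
rewrite /stat; apply: le_trans (ler_wpM2l _ hsum) _.
  by rewrite divr_ge0 ?maxnorm_ge0.
rewrite le_eqVlt; apply/orP; left; apply/eqP.
have mn : m%:R != 0 :> R by rewrite pnatr_eq0 -lt0n.
have -> : N%:R = 2 * m%:R :> R by rewrite -mul2n natrM.
by field.
Qed.

(** The factor 80 makes t^2 / (20 K^2 rho^2) equal to 4 ln N, that is N^(-4) per event; the union
    runs over at most N^2 edges, [p] columns and two signs. *)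
Lemma slice_tail (w0 : T) (rho : R) : (0 < m)%N -> (0 < p)%N -> 0 < rho ->
  (forall c, \sum_i (Fdag w0 c i) ^+ 2 <= rho ^+ 2) ->
  (P ([set w | Phi w = Phi w0] `&`
      [set w | (rho * (sigma + 1) * Num.sqrt (80 * ln N%:R) < maxnorm (Fdag w0 *m E w))%R])
   <= P [set w | Phi w = Phi w0] * (2 * p%:R / N%:R ^+ 2)%:E)%E.
Proof.
move=> m0 p0 rho0 hrho; set K := sigma + 1; set t := _ * Num.sqrt _.
set A := [set w | Phi w = Phi w0].
have mA : measurable A by exact: measurable_Phi_eq.
have N0 : 0 < N%:R :> R by rewrite ltr0n double_gt0.
have N1 : 1 < N%:R :> R by rewrite ltr1n; lia.
have lnN : 0 < ln N%:R :> R by rewrite ln_gt0.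
have E2 i k : (\int[P]_w (expR (E w i k ^+ 2 / K ^+ 2))%:E <= 2%:E)%E.
  have := (@subg_norm_entry _ (fun w => row i (E w)) sigma k _ (hEsubg i)).2.
  under eq_integral do rewrite mxE; apply => l.
  by under eq_fun do rewrite mxE; exact: hEmeas.
have K0 : 0 < K.
  have i0 : 'I_N by exists 0%N; rewrite double_gt0.
  apply: (@subg_norm_entry _ (fun w => row i0 (E w)) sigma (Ordinal p0) _ (hEsubg i0)).1 => l.
  by under eq_fun do rewrite mxE; exact: hEmeas.
have t0 : 0 < t by rewrite !mulr_gt0// sqrtr_gt0 mulr_gt0.
pose a := fine (P A).
have PA : P A = a%:E by rewrite fineK// fin_num_measure.
have a0 : 0 <= a by rewrite -lee_fin -PA.
pose q := #|edges (Phi w0)|.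
pose Ev (z : 'I_q * 'I_p * bool) := A `&`
  [set w | t <= \sum_i ((-1) ^+ z.2 * Fdag w0 z.1.1 i) * E w i z.1.2].
have mlin (z : 'I_q * 'I_p * bool) : measurable_fun setT
    (fun w => \sum_i ((-1) ^+ z.2 * Fdag w0 z.1.1 i) * E w i z.1.2 : R).
  by apply: measurable_sum => i; exact: measurable_funM.
apply: le_trans (@union_bound R d T P _ _ Ev (fun=> a * N%:R ^- 4) _ _ _ _) _.
- by apply: measurableI => //; apply: measurable_gt_set; exact: measurable_stat.
- move=> z; apply: measurableI => //; rewrite -[X in measurable X]setTI.
  exact: (measurable_fun_le measurableT (measurable_cst t) (mlin z)).
- move=> w [Aw /= tw].
  have [c [k ck]] : exists c k, t < `|(Fdag w0 *m E w) c k|.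
    apply: contrapT => /forallNP h; move: tw; apply/negP; rewrite -leNgt.
    apply: ler_maxnorm => [|c k]; first exact: ltW.
    by rewrite leNgt; apply/negP => ck; apply: (h c); exists k.
  (* The Boolean is the sign bit that turns the entry into its absolute value. *)
  exists (c, k, (Fdag w0 *m E w) c k < 0); split=> //=.
  have -> : \sum_i (-1) ^+ ((Fdag w0 *m E w) c k < 0)%R * Fdag w0 c i * E w i k =
            `|(Fdag w0 *m E w) c k|.
    rewrite normrEsign [X in _ = _ * X]mxE mulr_sumr.
    by apply: eq_bigr => i _; rewrite mulrA.
  exact: ltW.
- move=> [[c k] b] /=; rewrite /Ev/=.
  have := @subgaussian_sum_tail R d T P 'I_N (fun i w => E w i k) A
    (fun i => (-1) ^+ b * Fdag w0 c i) K rho t K0 rho0 t0 mA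
    (fun i => hEmeas i k) (fun i => hEint i k) (fun i => hEmean i k) (fun i => E2 i k)
    (fun B mB => slice_column_indep (Phi w0) k mB).
  have -> : t ^+ 2 / (20 * K ^+ 2 * rho ^+ 2) = 4 * ln N%:R.
    rewrite /t exprMn sqr_sqrtr ?mulr_ge0 ?ltW//.
    by field; rewrite !gt_eqF.
  have -> : expR (- (4 * ln N%:R)) = N%:R ^- 4 :> R.
    by rewrite expRN mulrC expRM_natr lnK ?posrE.
  rewrite PA -EFinM; apply.
  apply: le_trans (hrho c); apply: ler_sum => i _.
  by rewrite exprMn -exprM mulnC exprM sqrrN expr1n expr1n mul1r.
rewrite PA -EFinM lee_fin sumr_const !card_prod !card_ord card_bool -[leLHS]mulr_natl.
have qN : q%:R <= N%:R ^+ 2 :> R.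
  rewrite -natrX ler_nat /q; apply: leq_trans (max_card _) _.
  by rewrite card_prod !card_ord.
rewrite !natrM.
have -> : a * (2 * p%:R / N%:R ^+ 2) = N%:R ^+ 2 * (p%:R * 2 * (a * N%:R ^- 4)).
  by field; rewrite gt_eqF.
have -> : q%:R * p%:R * 2 * (a * N%:R ^- 4) = q%:R * (p%:R * 2 * (a * N%:R ^- 4)) by ring.
apply: ler_wpM2r qN; apply: mulr_ge0; first exact: mulr_ge0.
by rewrite mulr_ge0// invr_ge0 exprn_ge0// ltW.
Qed.

Hypothesis hPhiindep : mutually_indep P
     (fun e : {e : 'I_N * 'I_N | (e.1 < e.2)%N} =>
        rv_events (fun w => Phi w (val e).1 (val e).2)).
Hypothesis hBern : forall (i j : 'I_N), (i < j)%N ->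
     P [set w | Phi w i j = 1] =
       (if row i (Umat m c1 c2) == row j (Umat m c1 c2) then pw else pb)%:E.

Lemma card_block : (#|V| = m)%N.
Proof.
have mN : (m <= N)%N by rewrite -addnn leq_addr.
rewrite -[RHS]card_ord -(fintype.card_image (f := widen_ord mN)); last first.
  by move=> i j /(congr1 val)/= /val_inj.
apply: eq_card => i; rewrite inE; apply/idP/fintype.imageP => [im|[j _ ->]] //=.
by exists (Ordinal im) => //; exact: val_inj.
Qed.

Lemma sum_slices_le1 :
  \sum_(b : 'M[bool]_N) fine (P [set w | Phi w = bool_mx b]) <= 1.
Proof.
have mS b : measurable [set w | Phi w = bool_mx b] by exact: measurable_Phi_eq.
rewrite -lee_fin -sumEFin.
rewrite (eq_bigr (fun b => P [set w | Phi w = bool_mx b])); last first.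
  by move=> b _; rewrite fineK// fin_num_measure.
rewrite [X in (X <= _)%E]fsbig_seq ?index_enum_uniq//.
have <- := @measure_fin_bigcup _ _ _ P _ [set` index_enum 'M[bool]_N]
  (fun b => [set w | Phi w = bool_mx b]) finite_finset _ (fun b _ => mS b).
  by apply: probability_le1; apply: fin_bigcup_measurable => // b _; exact: finite_finset.
move=> b b' _ _ [w [/= -> /matrixP e]]; apply/matrixP => i j.
have := e i j; rewrite !mxE.
by case: (b i j); case: (b' i j) => // /eqP; rewrite ?oner_eq0// eq_sym oner_eq0.
Qed.

(** Distinct centres make equality of rows the same as membership of the same block. The bounds on
    [pw] and [pb] hold because each is the probability of an actual pair: vertices 0 and 1 share a
    block as [1 < m], while 0 and [m] do not. *)
Lemma block_bernoulli : (1 < m)%N -> c1 != c2 ->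
  [/\ 0 <= pw <= 1, 0 <= pb <= 1 & forall i j : 'I_N, (i < j)%N ->
     P [set w | Phi w i j = 1] = (if (i \in V) == (j \in V) then pw else pb)%:E].
Proof.
move=> m1 c12.
have rowE (i : 'I_N) : row i (Umat m c1 c2) = if i \in V then c1 else c2.
  by apply/rowP => k; rewrite !mxE inE; case: ifP.
have B (i j : 'I_N) : (i < j)%N ->
     P [set w | Phi w i j = 1] = (if (i \in V) == (j \in V) then pw else pb)%:E.
  move=> ij; rewrite hBern// !rowE; congr ((if _ then _ else _)%:E).
  case: (i \in V); case: (j \in V); rewrite ?eqxx//; first exact: negbTE.
  by rewrite eq_sym; exact: negbTE.
have range (i j : 'I_N) (x : R) : P [set w | Phi w i j = 1] = x%:E -> 0 <= x <= 1.
  move=> Px; rewrite -!lee_fin -Px measure_ge0/=.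
  apply: probability_le1; have := hPhimeas i j measurableT (measurable_set1 1).
  by rewrite setTI.
have h0 : (0 < N)%N by lia.
have h1 : (1 < N)%N by lia.
have h2 : (m < N)%N by lia.
split=> //.
  have /range := B (Ordinal h0) (Ordinal h1) isT.
  by rewrite !inE/= m1 (ltnW m1).
have /range := B (Ordinal h0) (Ordinal h2) (ltnW m1).
by rewrite !inE/= ltnn (ltnW m1).
Qed.

(** The premise on [C] is the deterministic bound for good graphs, taken as a hypothesis so that one
    [C] serves all sizes. A bad graph costs 9 / N; on good graphs the exceedance costs P(slice) 2 p
    / N^2 per slice, and the slices are disjoint. *)
Lemma LHS_tail (C : R) : 0 < C ->
  (forall (w : 'I_N -> 'I_N -> R) (x : 'I_N -> R) (j l : 'I_N),
   0 < pw -> pw <= 1 -> 0 < pb -> pb <= 1 ->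
   (forall i j, 0 <= w i j) -> (forall i j, w i j = w j i) ->
   good_graph w V (expR 1) pw pb -> \sum_i x i = 0 ->
   (forall z, dform w z x = 2 * (z j - z l)) ->
   norm2 x <= C * (1 / (m%:R * (pw + pb)) + 1 / (m%:R * Num.sqrt m%:R * pb * (pw + pb)))) ->
  (1 < m)%N -> (0 < p)%N -> c1 != c2 ->
  16 * ln N%:R <= m%:R * pw -> 16 * ln N%:R <= m%:R * pb ->
  (P [set w | (C * (sigma + 1) * Num.sqrt 80 * expR 1 * l2norm (c1 - c2) *
       (Num.sqrt (ln N%:R) * (pb / (pw + pb) + 1 / (Num.sqrt N%:R * (pw + pb))))
       < LHS w)%R] <= ((9 + 2 * p%:R) / N%:R)%:E)%E.
Proof.
move=> C0 H m1 p0 c12 hpw hpb.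
have m0 : (0 < m)%N by lia.
have mR : 0 < m%:R :> R by rewrite ltr0n.
have N0 : 0 < N%:R :> R by rewrite ltr0n double_gt0.
have N1 : 1 < N%:R :> R by rewrite ltr1n; lia.
have NE : N%:R = 2 * m%:R :> R by rewrite -mul2n natrM.
have lnN : 0 < ln N%:R :> R by rewrite ln_gt0.
have [/andP[_ pw1] /andP[_ pb1] B] := block_bernoulli m1 c12.
have pw0 : 0 < pw by rewrite -(pmulr_rgt0 _ mR); apply: lt_le_trans hpw; rewrite mulr_gt0.
have pb0 : 0 < pb by rewrite -(pmulr_rgt0 _ mR); apply: lt_le_trans hpb; rewrite mulr_gt0.
have s0 : 0 < pw + pb by rewrite addr_gt0.
set K := sigma + 1.
have K0 : 0 < K.
  have i0 : 'I_N by exists 0%N; rewrite double_gt0.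
  apply: (@subg_norm_entry _ (fun w => row i0 (E w)) sigma (Ordinal p0) _ (hEsubg i0)).1 => l.
  by under eq_fun do rewrite mxE; exact: hEmeas.
set dl := l2norm (c1 - c2).
have dl0 : 0 <= dl by exact: sqrtr_ge0.
have e0 : 0 < expR 1 :> R by exact: expR_gt0.
pose r := Num.sqrt m%:R : R.
have r0 : 0 < r by rewrite sqrtr_gt0.
have rn0 : 0 < Num.sqrt N%:R :> R by rewrite sqrtr_gt0.
set L := Num.sqrt (ln N%:R).
have L0 : 0 <= L by exact: sqrtr_ge0.
set c := C * K * _ * _ * _ * _.
pose rho := C * (1 / (m%:R * (pw + pb)) + 1 / (m%:R * r * pb * (pw + pb))).
have rho0 : 0 < rho by rewrite mulr_gt0// addr_gt0// divr_gt0// !mulr_gt0.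
pose D := expR 1 * (m%:R * pb).
have D0 : 0 <= D by rewrite !mulr_ge0// ltW.
pose t := rho * K * Num.sqrt (80 * ln N%:R).
have t0 : 0 <= t by apply: mulr_ge0 (sqrtr_ge0 _); apply: mulr_ge0; exact: ltW.
(* The factor m pb in [D] turns the two terms of [rho] into those of the rate, and sqrt N <= 2 sqrt
   m passes from [m] to [N]. *)
have tc : t * (D * dl / 2) <= c.
  have rN : Num.sqrt N%:R <= 2 * r.
    rewrite -(@ler_pXn2r _ 2)// ?nnegrE ?mulr_ge0 ?sqrtr_ge0//.
    by rewrite exprMn !sqr_sqrtr ?ler0n// NE; lra.
  have -> : t * (D * dl / 2) = C * K * Num.sqrt 80 * expR 1 * dl *
      (L * (pb / (pw + pb) / 2 + 1 / (2 * r * (pw + pb)))).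
    rewrite /t /rho /D sqrtrM ?ler0n// -/L.
    by field; rewrite !gt_eqF.
  rewrite /c ler_wpM2l//.
    by rewrite !mulr_ge0 ?sqrtr_ge0 ?(ltW C0) ?(ltW K0) ?(ltW e0).
  rewrite ler_wpM2l// lerD//.
    by have := divr_ge0 (ltW pb0) (ltW s0); lra.
  by rewrite !div1r lef_pV2 ?posrE ?mulr_gt0// ler_pM2r.
pose Good phi := good_graph (fun_of_matrix phi) V (expR 1) pw pb.
pose q (i j : 'I_N) := if (i \in V) == (j \in V) then pw else pb.
have PG : (P [set w | ~ Good (Phi w)] <= (9 / N%:R)%:E)%E.
  apply: (@good_graph_prob R d T P N Phi q hPhimeas hPhi01 hPhisym hPhidiag hPhiindep
    _ B V m pw pb m0 erefl card_block (ltW pw0) (ltW pb0) _ hpw hpb) => //.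
  by move=> i j; rewrite /q eq_sym.
pose y := 2 * p%:R / N%:R ^+ 2 : R.
have y0 : 0 <= y by rewrite divr_ge0 ?mulr_ge0 ?exprn_ge0// ltW.
have PB : (P [set w | Good (Phi w) /\ (c < LHS w)%R] <= y%:E)%E.
  pose Bb b := [set w | Phi w = bool_mx b] `&` [set w | Good (Phi w) /\ c < LHS w].
  have mGL : measurable [set w | Good (Phi w) /\ c < LHS w].
    rewrite (_ : [set w | _] = [set w | Good (Phi w)] `&` [set w | c < LHS w])//.
    by apply: measurableI; [exact: (measurable_Phi hPhimeas hPhi01)|exact: measurable_LHS_gt].
  apply: le_trans (@union_bound R d T P _ _ Bb
    (fun b => fine (P [set w | Phi w = bool_mx b]) * y) mGL _ _ _) _.
  - by move=> b; apply: measurableI => //; exact: measurable_Phi_eq.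
  - by move=> w hw; have [b bE] := Phi_bool hPhi01 w; exists b.
  - move=> b; have mb : measurable [set w | Phi w = bool_mx b] by exact: measurable_Phi_eq.
    (* Either the slice contains a good outcome [w0], whose pseudoinverse then serves the whole
       slice, or the event is empty there. *)
    have [[w0 [bE gw0]]|nb] := pselect (exists w, Phi w = bool_mx b /\ Good (Phi w)); last first.
      rewrite (_ : Bb b = set0) ?measure0 ?lee_fin ?mulr_ge0 ?fine_ge0//.
      by apply/seteqP; split => w //= -[e [g _]]; apply: nb; exists w.
    have hrho (l : 'I_#|edges (Phi w0)|) : \sum_i (Fdag w0 l i) ^+ 2 <= rho ^+ 2.
      rewrite -sqr_norm2 ler_pXn2r ?nnegrE ?norm2_ge0 ?(ltW rho0)//.
      apply: (H (Phi w0) _ (enum_val l).1 (enum_val l).2) => //.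
      + by move=> i j; case: (hPhi01 w0 i j) => ->.
      + exact: sum_pinv_row.
      + exact: dform_pinv_row.
    have := slice_tail m0 p0 rho0 hrho; rewrite -bE -/y => tail.
    rewrite EFinM fineK; last by rewrite fin_num_measure// bE.
    apply: le_trans tail; apply: le_measure.
    + by apply/mem_set; apply: measurableI => //; rewrite bE.
    + apply/mem_set; apply: measurableI; first by rewrite bE.
      by apply: measurable_gt_set; exact: measurable_stat.
    move=> w [/= ew [gw]]; rewrite /LHS (stat_congr _ (etrans ew (esym bE)) (hFdag w) (hFdag w0)) => cw.
    split; first by rewrite /= ew.
    rewrite /= ltNge; apply/negP => mt; move: cw; apply/negP; rewrite -leNgt.
    have degb i : \sum_(j | (i \in V) != (j \in V)) Phi w0 i j <= D.
      by have [_ _ _ h _] := gw0; move: h; rewrite card_block; exact.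
    apply: le_trans (stat_le _ _ m0 (hPhi01 w0) card_block D0 degb) _.
    by apply: le_trans tc; rewrite ler_wpM2r// divr_ge0// mulr_ge0.
  rewrite -mulr_suml lee_fin -[leRHS]mul1r ler_wpM2r//; exact: sum_slices_le1.
have mC : measurable [set w | Good (Phi w) /\ c < LHS w].
  rewrite (_ : [set w | _] = [set w | Good (Phi w)] `&` [set w | c < LHS w])//.
  by apply: measurableI; [exact: (measurable_Phi hPhimeas hPhi01)|exact: measurable_LHS_gt].
have sub : [set w | c < LHS w] `<=`
    [set w | ~ Good (Phi w)] `|` [set w | Good (Phi w) /\ c < LHS w].
  by move=> w cw; have [g|] := pselect (Good (Phi w)); [right|left].
apply: le_trans (union_bound2 (measurable_LHS_gt c)
  (measurable_Phi hPhimeas hPhi01 (fun phi => ~ Good phi)) mC sub PG PB) _.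
rewrite lee_fin [leRHS]mulrDl lerD2l /y ler_pM2l ?mulr_gt0 ?ltr0n//.
by rewrite lef_pV2 ?posrE ?exprn_gt0// expr2 ler_peMr// ltW.
Qed.

End FixedSize.

(** * Passage to the limit *)

Section Asymptotics.
Context {R : realType}.

Lemma near_infty_le_div (x eps : R) : 0 < eps ->
  \forall m \near \oo, x / (m.*2)%:R < eps.
Proof.
move=> eps0; near=> m.
have m0 : (0 < m)%N by near: m; exact: nbhs_infty_gt.
have xm : x / eps <= m%:R by near: m; exact: nbhs_infty_ger.
have mR : 0 < m%:R :> R by rewrite ltr0n.
have NE : (m.*2)%:R = m%:R + m%:R :> R by rewrite -addnn natrD.
rewrite ltr_pdivrMr ?ltr0n ?double_gt0// NE mulrDr.
move: xm; rewrite ler_pdivrMr// => xm.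
have := mulr_gt0 eps0 mR; lra.
Unshelve. all: by end_near. Qed.

(** With n = 2 m, the constant 32 in the growth condition becomes 16 after multiplication by [m]. *)
Lemma expected_degree_ge (m : nat) (x : R) : (0 < m)%N -> 0 <= x ->
  32 * `|ln (m.*2)%:R / (m.*2)%:R| <= `|x| -> 16 * ln (m.*2)%:R <= m%:R * x.
Proof.
move=> m0 x0; have mR : 0 < m%:R :> R by rewrite ltr0n.
have NE : (m.*2)%:R = 2 * m%:R :> R by rewrite -mul2n natrM.
have l0 : 0 <= ln (m.*2)%:R :> R by rewrite ln_ge0// ler1n double_gt0.
rewrite [`|x|]ger0_norm// ger0_norm ?divr_ge0//.
set l := ln _; rewrite NE => h.
have := ler_wpM2l (ltW mR) h.
have -> : m%:R * (32 * (l / (2 * m%:R))) = 16 * l by field; rewrite gt_eqF.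
by [].
Qed.

End Asymptotics.

(* Index m: the sample size is n = m.*2 (n even), n -> oo as m -> oo.
   The dimension p, the centres c1 c2 and the sub-Gaussian norm sigma (= sigma_p)
   are fixed; pw, pb are sequences in m (i.e. in n). *)
Theorem theorem3p5
  (R : realType)
  (d : nat -> measure_display) (T : forall m, measurableType (d m))
  (P : forall m, probability (T m) R)
  (p : nat) (c1 c2 : 'rV[R]_p) (sigma : R) (pw pb : nat -> R)
  (E : forall m, T m -> 'M[R]_(m.*2, p))
  (Phi : forall m, T m -> 'M[R]_(m.*2))
  (Fdag : forall m (w : T m), 'M[R]_(#|edges (Phi m w)|, m.*2))
  (* noise E: rows independent, mean zero, sub-Gaussian norm sigma *)
  (hEmeas : forall m i k, measurable_fun setT (fun w => E m w i k))
  (hEint : forall m i k, (P m).-integrable setT (fun w => (E m w i k)%:E))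
  (hEmean : forall m i k, (\int[P m]_w (E m w i k)%:E = 0)%E)
  (hEsubg : forall m i, subg_norm (P m) (fun w => row i (E m w)) = sigma%:E)
  (hErows : forall m, mutually_indep (P m) (row_events (E m)))
  (* Phi: random symmetric 0/1 matrix with zero diagonal *)
  (hPhimeas : forall m i j, measurable_fun setT (fun w => Phi m w i j))
  (hPhi01 : forall m w i j, Phi m w i j = 0 \/ Phi m w i j = 1)
  (hPhisym : forall m w i j, Phi m w i j = Phi m w j i)
  (hPhidiag : forall m w i, Phi m w i i = 0)
  (* entries Phi_ij, i<j, independent Bernoulli *)
  (hPhiindep : forall m, mutually_indep (P m)
     (fun e : {e : 'I_(m.*2) * 'I_(m.*2) | (e.1 < e.2)%N} =>
        rv_events (fun w => Phi m w (val e).1 (val e).2)))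
  (hBern : forall m (i j : 'I_(m.*2)), (i < j)%N ->
     P m [set w | Phi m w i j = 1] =
       (if row i (Umat m c1 c2) == row j (Umat m c1 c2) then pw m else pb m)%:E)
  (* Phi independent of E *)
  (hPhiE : forall m, indep2 (P m) (fmx_events (Phi m)) (mx_events (E m)))
  (* Fdag is the Moore--Penrose pseudoinverse of the incidence matrix F *)
  (hFdag : forall m w, is_MP_pinv (incidence (Phi m w)) (Fdag m w))
  (* asymptotic regime *)
  (hpw : little_omega pw (fun m => ln (m.*2)%:R / (m.*2)%:R))
  (hpb : little_omega pb (fun m => ln (m.*2)%:R / (m.*2)%:R))
  (hpwb : little_omega (fun m => (m.*2)%:R * pb m ^+ 2 / (pw m + pb m))
                       (fun m => ln (m.*2)%:R)) :
  let LHS := fun m (w : T m) =>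
    maxnorm (Fdag m w *m E m w) / (m.*2)%:R *
      \sum_(e in edges (Phi m w))
         Num.sqrt (Phi m w e.1 e.2) *
         l2norm (row e.1 (Umat m c1 c2) - row e.2 (Umat m c1 c2)) in
  bigO_p P LHS
    (fun m => Num.sqrt (ln (m.*2)%:R) *
       (pb m / (pw m + pb m) + 1 / (Num.sqrt (m.*2)%:R * (pw m + pb m))))
  /\
  (little_omega pw (fun m => Num.sqrt (ln (m.*2)%:R / (m.*2)%:R)) ->
   little_omega pw (fun m => pb m * Num.sqrt (ln (m.*2)%:R)) ->
   cvg_prob0 P LHS).
Proof.
move=> LHS; set a := fun m => Num.sqrt (ln _) * _.
have LHS0 m w : 0 <= LHS m w.
  apply: mulr_ge0; first by rewrite divr_ge0 ?maxnorm_ge0.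
  by apply: sumr_ge0 => e _; rewrite mulr_ge0 ?sqrtr_ge0.
(* For equal centres [hBern] only speaks of [pw], so the graph estimates cannot be invoked; the
   statistic vanishes identically instead. *)
have [c12|c12] := eqVneq c1 c2.
  have z m w : LHS m w = 0.
    rewrite /LHS big1 ?mulr0// => e _.
    have rowE i : row i (Umat m c1 c2) = c1 by apply/rowP => k; rewrite !mxE -c12; case: ifP.
    by rewrite !rowE subrr /l2norm big1 ?sqrtr0 ?mulr0// => k _; rewrite mxE expr0n.
  split=> [eps eps0|_ _ eps eps0].
    exists 1; split=> //; near=> m.
    rewrite (_ : [set w | _] = set0) ?measure0 ?lte_fin//.
    by apply/seteqP; split => w //=; rewrite z normr0 mul1r ltNge normr_ge0.
  rewrite (_ : (fun m => _) = fun=> 0); first exact: cvg_cst.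
  apply/funext => m; rewrite (_ : [set w | _] = set0) ?measure0//.
  by apply/seteqP; split => w //=; rewrite z normr0 ltNge (ltW eps0).
have p0 : (0 < p)%N.
  by rewrite lt0n; apply: contraNneq c12 => pE; apply/eqP/rowP => k;
     have := ltn_ord k; rewrite [X in (_ < X)%N]pE.
have mLHS m (c : R) : measurable [set w | c < LHS m w].
  exact: (@measurable_LHS_gt R (d m) (T m) m p c1 c2 (E m) (Phi m) (Fdag m)).
(* The constant is fixed here, before [m], with the degree slack of the upper Chernoff bound. *)
have [C [C0 HC]] := @good_graph_norm2 R (expR 1) (le_trans (ltW (ltr1n R 2)) (expR1_ge2 (R := R))).
have large : \forall m \near \oo, [/\ (1 < m)%N, 0 < pw m, 0 <= pb m &
    (P m [set w | (C * (sigma + 1) * Num.sqrt 80 * expR 1 * l2norm (c1 - c2) * a m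
       < LHS m w)%R] <= ((9 + 2 * p%:R) / (m.*2)%:R)%:E)%E].
  near=> m.
  have m1 : (1 < m)%N by near: m; exact: nbhs_infty_gt.
  have m0 : (0 < m)%N by exact: ltnW.
  have [/andP[pw0 _] /andP[pb0 _] _] :=
    @block_bernoulli R _ _ (P m) m p c1 c2 (pw m) (pb m) (Phi m) (hPhimeas m) (hBern m) m1 c12.
  have h1 : 16 * ln (m.*2)%:R <= m%:R * pw m.
    by apply: expected_degree_ge => //; near: m; exact: hpw.
  have h2 : 16 * ln (m.*2)%:R <= m%:R * pb m.
    by apply: expected_degree_ge => //; near: m; exact: hpb.
  have lnN : 0 < ln (m.*2)%:R :> R by rewrite ln_gt0// ltr1n; lia.
  have pwp : 0 < pw m.
    rewrite -(@pmulr_rgt0 _ m%:R) ?ltr0n//; apply: lt_le_trans h1.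
    by rewrite mulr_gt0.
  split=> //.
  apply: (@LHS_tail R _ _ (P m) m p c1 c2 sigma (pw m) (pb m) (E m) (Phi m) (Fdag m) (hEmeas m)
    (hEint m) (hEmean m) (hEsubg m) (hErows m) (hPhimeas m) (hPhi01 m) (hPhisym m) (hPhidiag m)
    (hPhiE m) (hFdag m) (hPhiindep m) (hBern m) C C0) => //.
  move=> w x j l w1 w2 w3 w4 w5 w6 w7 w8 w9.
  have cV := card_block m.
  have cVc : (#|~: [set i : 'I_(m.*2) | (i < m)%N]%SET| = m)%SET.
    apply/eqP; rewrite -(eqn_add2l m) addnn; apply/eqP.
    by rewrite -[X in (X + _)%N]cV cardsC card_ord.
  have := HC _ w _ (pw m) (pb m) x j l _ _ w1 w2 w3 w4 w5 w6 w7 w8 w9.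
  by rewrite cV; apply.
have a0 m : 0 < pw m -> 0 <= pb m -> 0 <= a m.
  move=> pw0 pb0; rewrite /a mulr_ge0 ?sqrtr_ge0// addr_ge0// divr_ge0//.
    by rewrite addr_ge0// ltW.
  by rewrite mulr_ge0 ?sqrtr_ge0// addr_ge0// ltW.
have bigO : bigO_p P LHS a.
  move=> eps eps0; set M0 := C * (sigma + 1) * _ * _ * _ in large.
  (* Positive whatever the sign of [M0], and at least [M0]. *)
  exists (`|M0| + 1); split; first by rewrite ltr_wpDl.
  near=> m.
  have [m1 pw0 pb0 tail] : [/\ (1 < m)%N, 0 < pw m, 0 <= pb m &
    (P m [set w | (M0 * a m < LHS m w)%R] <= ((9 + 2 * p%:R) / (m.*2)%:R)%:E)%E].
    by near: m; exact: large.
  apply: (@le_lt_trans _ _ ((9 + 2 * p%:R) / (m.*2)%:R)%:E); last first.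
    by rewrite lte_fin; near: m; exact: near_infty_le_div.
  have E1 : [set w | ((`|M0| + 1) * `|a m| < `|LHS m w|)%R] =
            [set w | ((`|M0| + 1) * `|a m| < LHS m w)%R].
    by apply/seteqP; split => w /=; rewrite [`|LHS m w|]ger0_norm.
  rewrite E1; apply: le_trans tail; apply: le_measure.
  - exact/mem_set/mLHS.
  - exact/mem_set/mLHS.
  move=> w /=; apply: le_lt_trans; rewrite [`|a m|]ger0_norm ?a0// ler_wpM2r ?a0//.
  by have := ler_norm M0; lra.
split=> // hw1 hw2 eps eps0; apply/cvgr0Pnorm_lt => del del0.
have [M [M0 PM]] := bigO del del0.
near=> m.
have [m1 pw0 pb0 _] : [/\ (1 < m)%N, 0 < pw m, 0 <= pb m &
    (P m [set w | (C * (sigma + 1) * Num.sqrt 80 * expR 1 * l2norm (c1 - c2) * a m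
       < LHS m w)%R] <= ((9 + 2 * p%:R) / (m.*2)%:R)%:E)%E].
  by near: m; exact: large.
have PMm : (P m [set w | (M * `|a m| < `|LHS m w|)%R] < del%:E)%E by near: m; exact: PM.
(* Multiplied by pw + pb, the rate is a sum of two terms, each at most pw / Q by the extra growth
   conditions; hence M a <= 2 M / Q = eps. *)
pose Q := 2 * M / eps.
have Q0 : 0 < Q by rewrite divr_gt0// mulr_gt0.
have q1 : Q * `|Num.sqrt (ln (m.*2)%:R / (m.*2)%:R)| <= `|pw m| by near: m; exact: hw1.
have q2 : Q * `|pb m * Num.sqrt (ln (m.*2)%:R)| <= `|pw m| by near: m; exact: hw2.
rewrite [`|pw m|]gtr0_norm// ger0_norm ?sqrtr_ge0// in q1.
rewrite [`|pw m|]gtr0_norm// ger0_norm ?mulr_ge0 ?sqrtr_ge0// in q2.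
have N0 : 0 < (m.*2)%:R :> R by rewrite ltr0n double_gt0 (ltnW m1).
have l0 : 0 <= ln (m.*2)%:R :> R by rewrite ln_ge0// ler1n double_gt0 (ltnW m1).
have rN0 : 0 < Num.sqrt (m.*2)%:R :> R by rewrite sqrtr_gt0.
have s0 : 0 < pw m + pb m by rewrite ltr_wpDr.
have Ma : M * `|a m| <= eps.
  rewrite ger0_norm ?a0//.
  have -> : a m = (pb m * Num.sqrt (ln (m.*2)%:R) +
     Num.sqrt (ln (m.*2)%:R / (m.*2)%:R)) / (pw m + pb m).
    by rewrite /a sqrtrM// sqrtrV ?ler0n//; field; rewrite !gt_eqF.
  rewrite mulrA ler_pdivrMr//.
  have : Q * (pb m * Num.sqrt (ln (m.*2)%:R) + Num.sqrt (ln (m.*2)%:R / (m.*2)%:R)) <= 2 * pw m by lra.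
  move=> /(ler_wpM2l (ltW eps0)).
  have -> : eps * (Q * (pb m * Num.sqrt (ln (m.*2)%:R) + Num.sqrt (ln (m.*2)%:R / (m.*2)%:R)))
    = 2 * (M * (pb m * Num.sqrt (ln (m.*2)%:R) + Num.sqrt (ln (m.*2)%:R / (m.*2)%:R))).
    by rewrite /Q; field; rewrite gt_eqF.
  have := mulr_ge0 (ltW eps0) pb0; lra.
have E1 (c : R) : [set w | (c < `|LHS m w|)%R] = [set w | (c < LHS m w)%R].
  by apply/seteqP; split => w /=; rewrite [`|LHS m w|]ger0_norm.
rewrite E1 in PMm; rewrite E1 ger0_norm ?fine_ge0//.
rewrite -lte_fin fineK ?fin_num_measure//.
apply: le_lt_trans PMm; apply: le_measure.
- exact/mem_set/mLHS.
- exact/mem_set/mLHS.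
by move=> w /=; apply: le_lt_trans.
Unshelve. all: by end_near. Qed.
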